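(* Fix universal constants $\gamma\in(0,1]$, $K\ge1$. Let $L$ be a positive integer and $d_0,d_1,\dots,d_L$ positive integers with $\max\{d_0,\dots,d_L\}\le K L^{1-\gamma}$. Let $X\in\mathbb{R}^{d_0\times n}$, $W^*\in\mathbb{R}^{d_L\times d_0}$, $Y=W^*X$, with $K^{-1}\le\|X\|_F\le K$ and $K^{-1}\le\|Y\|_F\le K$. Consider the linear network $f(x;W_1,\dots,W_L)=\alpha W_L\cdots W_1x$ with $W_i\in\mathbb{R}^{d_i\times d_{i-1}}$, the loss $\ell(W_1,\dots,W_L)=\frac12\|\alpha W_L\cdots W_1X-Y\|_F^2$, and gradient descent $W_i(t+1)=W_i(t)-\eta\frac{\partial\ell}{\partial W_i}(W_1(t),\dots,W_L(t))$ from an initialization in which all entries of all $W_i(0)$ are independent and each entry of $W_i(0)$ is distributed as $\mathcal N(0,\sigma_i^2)$, where $\sigma_i>0$ and $\alpha>0$ satisfy $$\alpha^2\prod_{i=1}^L(d_i\sigma_i^2)\le L^K\quad\text{and}\quad d_i\sigma_i^2\ge L^{-K}\ \ \forall i\in[L].$$ Then there exist constants $c>0$, $c'>0$ and $L_0$, depending only on $\gamma$ and $K$, such that whenever $L\ge L_0$ and $0<\eta\le e^{cL^\gamma}$, with probability at least $0.9$ over the random initialization, $0.4\|Y\|_F^2\le\ell(W_1(t),\dots,W_L(t))\le0.6\|Y\|_F^2$ for all integers $0\le t\le e^{c'L^\gamma}$.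
   Context: $\|\cdot\|_F$ is the Frobenius norm; $[L]=\{1,\dots,L\}$. Note $\mathbb{E}\|f(x;W_1(0),\dots,W_L(0))\|^2=\alpha^2\prod_i(d_i\sigma_i^2)\|x\|^2$. *)

(* Defs.v *)
From HB Require Import structures.
From mathcomp Require Import all_boot all_order all_algebra.
From mathcomp Require Import all_classical all_reals all_analysis.
Set Implicit Arguments. Unset Strict Implicit. Unset Printing Implicit Defensive.
Import Order.TTheory GRing.Theory Num.Theory.
Import numFieldNormedType.Exports.
Local Open Scope classical_set_scope.
Local Open Scope ring_scope.

Section Defs.
Variable R : realType.

(* All weights of the network, stored flat: [W i a b] is entry (a,b) of the
   matrix W_i (layer i, 1 <= i <= L, a < d_i, b < d_{i-1}).  Entries outside
   these ranges are never used by the network. *)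
Definition weights := nat -> nat -> nat -> R.

Definition zeroW : weights := fun _ _ _ => 0.

Definition updW (W : weights) (k : nat * nat * nat) (x : R) : weights :=
  fun i a b => if (i, a, b) == k then x else W i a b.

Variable d : nat -> nat.

(* the matrix W_{k+1} in R^{d_{k+1} x d_k} *)
Definition layer (W : weights) (k : nat) : 'M[R]_(d k.+1, d k) :=
  \matrix_(a, b) W k.+1 a b.

Fixpoint prodW (W : weights) (k : nat) : 'M[R]_(d k, d 0) :=
  match k as k0 return 'M[R]_(d k0, d 0) with
  | 0 => 1%:M
  | k'.+1 => layer W k' *m prodW W k'
  end.

Definition frob2 (m p : nat) (M : 'M[R]_(m, p)) : R :=
  \sum_(i < m) \sum_(j < p) M i j ^+ 2.

Definition frob (m p : nat) (M : 'M[R]_(m, p)) : R := Num.sqrt (frob2 M).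

Definition loss (L n : nat) (alpha : R) (X : 'M[R]_(d 0, n)) (Y : 'M[R]_(d L, n))
  (W : weights) : R :=
  2^-1 * frob2 (alpha *: (prodW W L *m X) - Y).

Definition grad_loss (L n : nat) (alpha : R) (X : 'M[R]_(d 0, n))
  (Y : 'M[R]_(d L, n)) (W : weights) : weights :=
  fun i a b => derive1 (fun x : R => loss alpha X Y (updW W (i, a, b) x)) (W i a b).

Fixpoint gd (L n : nat) (alpha eta : R) (X : 'M[R]_(d 0, n))
  (Y : 'M[R]_(d L, n)) (W0 : weights) (t : nat) : weights :=
  match t with
  | 0 => W0
  | t'.+1 => let W := gd alpha eta X Y W0 t' in
             fun i a b => W i a b - eta * grad_loss alpha X Y W i a b
  end.

Definition entries (L : nat) : seq (nat * nat * nat) :=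
  flatten [seq [seq (i, a, b) | a <- iota 0 (d i), b <- iota 0 (d i.-1)] | i <- iota 1 L].

(* Expectation of F over independent entries, entry (i,a,b) ~ N(0, sigma_i^2),
   as an iterated integral (product of the Gaussian measures); entries outside
   the list are set to 0. *)
Fixpoint gauss_iter (sigma : nat -> R) (s : seq (nat * nat * nat))
  (F : weights -> \bar R) : \bar R :=
  match s with
  | [::] => F zeroW
  | k :: s' => (\int[normal_prob 0 (sigma k.1.1)]_x
                  gauss_iter sigma s' (fun W => F (updW W k x)))%E
  end.

Definition init_prob (L : nat) (sigma : nat -> R) (P : weights -> Prop) : \bar R :=
  gauss_iter sigma (entries L) (fun W => (\1_[set W' | P W'] W)%:E).

End Defs.

(* Main.v *)
(* The log-norm of [W_k v / (sqrt d_k sigma_k)] has negative drift of order [-1/d_k]: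
   comparing a square root with a cubic polynomial gives
   [E |W_k v| <= sigma_k sqrt d_k (1 - 1/(16 d_k)) |v|]. Hence a product of consecutive layers
   has, simultaneously for all segments and up to a factor polynomial in [L] (Markov and a
   union bound), norm at most the product [Q] of these rates, and [alpha Q] over the whole
   network is [e^(-Omega(L^gamma))]. The gradient at layer [k] is controlled by the segments
   above and below [k], so it is exponentially small as well; a telescoping expansion shows
   that segment bounds degrade by at most a factor 2 as long as each layer moves by a
   polynomially small fraction of its rate, which is the case for exponentially many steps.
   The output therefore stays negligible and the loss stays near [|Y|^2 / 2]. *)

(* The second moment cannot reveal any decay: [E |W_k v|^2] equals [d_k sigma_k^2 |v|^2] exactly,
   and the hypothesis lets the product of these factors with [alpha^2] be as large as [L^K]. The
   decay is visible only in first moments, hence the square root. With [s] the squared norm divided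
   by its mean, a polynomial majorant of [sqrt s] on [s >= 0] gives a mean below 1 only if it is not
   convex. A quadratic majorant must have a nonnegative leading coefficient, so by Jensen it gains
   nothing; degree three is the least that works, and it needs only Gaussian moments up to order
   six, which are computed exactly.

   The event of the theorem speaks of whole trajectories and is never shown measurable.
   Probabilities are therefore bounded below through a measurable minorant of the indicator, and the
   iterated integral is kept in its given order: lower layers are outer variables, so conditioning
   on them is mere partial evaluation.

   The exponential budget is [Z ^+ 2], the inverse of the decay of the product of rates: one factor
   [Z] pays for step size times number of steps, the other for everything polynomial in [L]. *)
Require Import Defs.
From HB Require Import structures.
From mathcomp Require Import all_boot all_order all_algebra.
From mathcomp Require Import all_classical all_reals all_analysis.
From mathcomp Require Import measurable_realfun ring lra zify.
Set Implicit Arguments. Unset Strict Implicit. Unset Printing Implicit Defensive.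
Import Order.TTheory GRing.Theory Num.Theory.
Import numFieldNormedType.Exports.
Local Open Scope classical_set_scope.
Local Open Scope ring_scope.

(** * Gaussian moments *)
Section NormalMoments.
Variable R : realType.
Local Notation mu := (@lebesgue_measure R).

(** The Radon-Nikodym derivative of [normal_prob m s] has the same integral as [normal_pdf m s] over
    every measurable set, so the two agree almost everywhere. *)
Lemma ge0_integral_normal_prob (m s : R) (f : R -> \bar R) :
  (forall x, 0 <= f x)%E -> measurable_fun [set: R] f ->
  (\int[normal_prob m s]_x f x = \int[mu]_x (f x * (normal_pdf m s x)%:E))%E.
Proof.
move=> f0 mf.
have dom := normal_prob_dominates m s.
rewrite -(Radon_Nikodym_SigmaFinite.change_of_variables dom)//.
apply: ae_eq_integral => //.
- apply: emeasurable_funM => //.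
  exact: measurable_int (Radon_Nikodym_SigmaFinite.f_integrable _).
- apply: emeasurable_funM => //; apply/measurableT_comp => //.
  exact: measurable_normal_pdf.
- apply: ae_eqe_mul2l => /=; apply: integral_ae_eq => //=.
  + exact: Radon_Nikodym_SigmaFinite.f_integrable.
  + by apply/measurableT_comp =>//; exact: measurable_normal_pdf.
  + by move=> E E01 mE; rewrite -Radon_Nikodym_SigmaFinite.f_integral.
Qed.

Lemma integrable_normal_prob (m s : R) (f : R -> R) :
  measurable_fun [set: R] f ->
  mu.-integrable setT (fun x => (f x * normal_pdf m s x)%:E) ->
  (normal_prob m s).-integrable setT (EFin \o f).
Proof.
move=> mf /integrableP[_ h]; apply/integrableP; split.
  exact/measurable_EFinP.
rewrite ge0_integral_normal_prob//; last first.
  by apply: measurableT_comp => //; exact/measurable_EFinP.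
apply: le_lt_trans h; apply: ge0_le_integral => //=.
- by move=> x _; rewrite lee_fin mulr_ge0// normal_pdf_ge0.
- apply: measurableT_comp => //; apply: measurable_funM.
    exact: measurableT_comp.
  exact: measurable_normal_pdf.
- apply: measurableT_comp => //; apply: measurableT_comp => //.
  by apply: measurable_funM => //; exact: measurable_normal_pdf.
- by move=> x _; rewrite lee_fin normrM ler_wpM2l// ger0_norm// normal_pdf_ge0.
Qed.

Lemma integral_normal_prob (m s : R) (f : R -> R) :
  measurable_fun [set: R] f ->
  mu.-integrable setT (fun x => (f x * normal_pdf m s x)%:E) ->
  (\int[normal_prob m s]_x (f x)%:E = \int[mu]_x (f x * normal_pdf m s x)%:E)%E.
Proof.
move=> mf inf; have dom := normal_prob_dominates m s.
have infn := integrable_normal_prob mf inf.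
rewrite -(Radon_Nikodym_change_of_variables dom)//=.
under [RHS]eq_integral do rewrite EFinM.
apply: ae_eq_integral => //.
- apply: emeasurable_funM; first exact/measurable_EFinP.
  by apply: (measurable_int mu); exact: Radon_Nikodym_integrable.
- exact: measurable_int inf.
- apply: ae_eqe_mul2l => /=; apply: integral_ae_eq => //=.
  + exact: Radon_Nikodym_integrable.
  + by apply/measurableT_comp =>//; exact: measurable_normal_pdf.
  + by move=> E E01 mE; rewrite -Radon_Nikodym_integral.
Qed.

(** Doubling the standard deviation absorbs any power, because the quotient of the two densities
    decays like a Gaussian. This one bound yields both the integrability of all moments and the
    vanishing of boundary terms. *)
Lemma exprn_normal_pdf_le (s : R) (k : nat) : 0 < s ->
  exists2 C : R, 0 <= C & forall x,
    `|x ^+ k * normal_pdf 0 s x| <= C * normal_pdf 0 (2 * s) x.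
Proof.
move=> s0; have s20 : 2 * s != 0 by rewrite mulf_neq0// ?gt_eqF.
rewrite !normal_pdfE ?gt_eqF ?mulr_gt0//.
(* [a] is [1 / (2 s^2) - 1 / (8 s^2)], the difference of the two exponents. *)
pose a := 3 / (8 * s ^+ 2).
have a0 : 0 < a by rewrite divr_gt0// mulr_gt0// exprn_gt0.
pose C := 1 + a ^- k.+1 * k.+1`!%:R.
have C0 : 0 <= C by rewrite addr_ge0// mulr_ge0// invr_ge0 exprn_ge0// ltW.
have P0 : 0 < normal_peak (2 * s) by exact: normal_peak_gt0.
exists (normal_peak s * C / normal_peak (2 * s)).
  by rewrite divr_ge0 ?mulr_ge0// ?normal_peak_ge0.
move=> x /=; rewrite [leRHS]mulrA divfK ?gt_eqF//.
rewrite !normrM (ger0_norm (normal_peak_ge0 _)) (ger0_norm (normal_fun_ge0 _ _ _)).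
rewrite mulrCA -mulrA ler_wpM2l ?normal_peak_ge0// normrX.
have -> : normal_fun 0 s x = expR (- (a * x ^+ 2)) * normal_fun 0 (2 * s) x.
  rewrite /normal_fun -expRD; congr expR; rewrite /a subr0; field.
  by rewrite gt_eqF.
rewrite mulrA ler_wpM2r ?normal_fun_ge0// expRN -ler_pdivlMr ?invr_gt0 ?expR_gt0//.
rewrite invrK.
have y0 : 0 <= a * x ^+ 2 by rewrite mulr_ge0 ?sqr_ge0// ltW.
have h1 := @expR_ge1Dxn R (a * x ^+ 2) k y0.
(* Passing to an even power makes the bound comparable with one term of the series of
   [expR (a * x ^+ 2)]; the two summands of [C] match the two summands here. *)
have h2 : `|x| ^+ k <= 1 + (x ^+ 2) ^+ k.+1.
  have [x1|x1] := leP `|x| 1.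
    rewrite -[leLHS]addr0 lerD ?exprn_ile1//.
    by rewrite exprn_ge0// sqr_ge0.
  rewrite -real_normK ?num_real// -exprM.
  apply: (@le_trans _ _ (`|x| ^+ (2 * k.+1))); last by rewrite lerDr.
  rewrite ler_weXn2l ?(ltW x1)//.
  by rewrite mul2n -addnn addSn addnS ltnW// leqW// leq_addr.
apply: (le_trans h2); rewrite /C mulrDl mul1r lerD//.
  by apply: (le_trans _ h1); rewrite lerDl divr_ge0// exprn_ge0.
have -> : (x ^+ 2) ^+ k.+1 = a ^- k.+1 * k.+1`!%:R * ((a * x ^+ 2) ^+ k.+1 / k.+1`!%:R).
  rewrite (exprMn _ a); field.
  by rewrite pnatr_eq0 -lt0n fact_gt0 expf_neq0// gt_eqF.
rewrite ler_wpM2l//; first by rewrite mulr_ge0// invr_ge0 exprn_ge0// ltW.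
by apply: (le_trans _ h1); rewrite lerDr.
Qed.

Lemma measurable_exprn_normal_pdf (s : R) k :
  measurable_fun [set: R] (fun x : R => x ^+ k * normal_pdf 0 s x).
Proof.
apply: measurable_funM; last exact: measurable_normal_pdf.
exact: exprn_measurable.
Qed.

Lemma integrable_exprn_normal_pdf (s : R) k : 0 < s ->
  mu.-integrable setT (fun x : R => (x ^+ k * normal_pdf 0 s x)%:E).
Proof.
move=> s0; have [C C0 hC] := exprn_normal_pdf_le k s0.
apply: (@le_integrable _ _ _ mu _ measurableT _
  (fun x => C%:E * (normal_pdf 0 (2 * s) x)%:E)%E) => //=.
- apply/measurable_EFinP; exact: measurable_exprn_normal_pdf.
- move=> x _; rewrite lee_fin; apply: (le_trans (hC x)).
  exact: ler_norm.
- apply: integrableZl => //; exact: integrable_normal_pdf.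
Qed.

(** The bound for the power [k.+1] leaves a factor [1 / n] for the power [k]. Fixing only the
    absolute value of [u n] treats both ends of the line at once. *)
Lemma cvg_exprn_normal_pdf (s : R) k (u : nat -> R) : 0 < s ->
  (forall n, `|u n| = n%:R) ->
  u n ^+ k * normal_pdf 0 s (u n) @[n --> \oo] --> (0 : R).
Proof.
move=> s0 hu; have [C C0 hC] := exprn_normal_pdf_le k.+1 s0.
have s20 : 2 * s != 0 by rewrite mulf_neq0// ?gt_eqF.
rewrite -(cvg_shiftS (fun n => u n ^+ k * normal_pdf 0 s (u n))).
apply: norm_cvg0.
apply: (@squeeze_cvgr _ _ _ _ (fun=> 0) (fun n => (C * normal_peak (2 * s)) * n.+1%:R^-1)).
- near=> n; rewrite normr_ge0/= ler_pdivlMr ?ltr0n//.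
  rewrite -hu -normrM mulrAC -exprSr (le_trans (hC _))// ler_wpM2l//.
  exact: normal_pdf_ub.
- exact: cvg_cst.
- rewrite -[X in _ --> X](mulr0 (C * normal_peak (2 * s))).
  apply: cvgMr; exact: cvg_harmonic.
Unshelve. all: by end_near. Qed.

(** The fundamental theorem of calculus on [[-n, n]], with dominated convergence as [n] grows. *)
Lemma integral_derive_eq0 (F f : R -> R) :
  (forall x, is_derive x (1:R) F (f x)) -> continuous f ->
  mu.-integrable setT (EFin \o f) ->
  F n%:R @[n --> \oo] --> (0 : R) -> F (- n%:R) @[n --> \oo] --> (0 : R) ->
  (\int[mu]_x (f x)%:E = 0)%E.
Proof.
move=> dF cf intf Fp Fm.
have mf : measurable_fun [set: R] (EFin \o f) by exact: measurable_int intf.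
pose A n : set R := [set` `[- n%:R, n%:R]].
have cF x : {for x, continuous F}.
  apply: differentiable_continuous; apply/derivable1_diffP.
  by have [] := dF x.
have h1 : ((\int[mu]_(x in [set: R]) ((EFin \o f) \_ (A n)) x)%E @[n --> \oo] -->
           (\int[mu]_x (f x)%:E)%E).
  apply: (@dominated_cvg _ _ _ mu setT measurableT _ _ (abse \o (EFin \o f))) => //.
  - move=> n; apply: (measurable_restrictT (EFin \o f) (measurable_itv _)).1.
    exact: measurable_funTS.
  - move=> x _; apply: cvg_near_cst; exists `|Num.ceil `|x| |%N => // n /= hn.
    rewrite patchE ifT// inE /A /= in_itv/= -ler_norml.
    apply: (le_trans (ceil_ge _)); apply: (@le_trans _ _ `|Num.ceil `|x| |%N%:R).
      by rewrite natr_absz ler_int ler_norm.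
    by rewrite ler_nat.
  - exact: integrable_abse.
  - move=> n x _; rewrite patchE; case: ifP => // _; rewrite abse0; exact: abse_ge0.
have h2 : ((\int[mu]_(x in [set: R]) ((EFin \o f) \_ (A n)) x)%E @[n --> \oo] --> 0%E).
  (* The shift avoids the degenerate interval at [n = 0]: [continuous_FTC2] wants distinct
     endpoints. *)
  rewrite -(cvg_shiftS (fun n => \int[mu]_(x in [set: R]) ((EFin \o f) \_ (A n)) x)%E).
  rewrite (_ : (fun n => _) = (fun n => (F n.+1%:R - F (- n.+1%:R))%:E)).
    apply: cvg_EFin; first by apply: nearW.
    rewrite -[X in _ --> X](subr0 0); apply: cvgB.
      by rewrite (@cvg_shiftS _ (fun n => F n%:R)).
    by rewrite (@cvg_shiftS _ (fun n => F (- n%:R))).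
  apply/funext => j /=; rewrite -integral_mkcond /A.
  rewrite (@continuous_FTC2 R f F) ?EFinB//.
  - by rewrite -subr_gt0 opprK -natrD ltr0n.
  - exact: continuous_subspaceT.
  - split.
    + by move=> x _; have [] := dF x.
    + apply: cvg_at_right_filter; exact: cF.
    + apply: cvg_at_left_filter; exact: cF.
  - by move=> x _; rewrite derive1E; exact: derive_val.
by rewrite -(cvg_lim _ h1)// (cvg_lim _ h2).
Unshelve. all: by end_near. Qed.

Lemma is_derive_exprn_normal_pdf (s : R) k (x : R) : 0 < s ->
  is_derive x (1:R) (fun y => y ^+ k * normal_pdf 0 s y)
    (k%:R * (x ^+ k.-1 * normal_pdf 0 s x)
     - s ^- 2 * (x ^+ k.+1 * normal_pdf 0 s x)).
Proof.
move=> s0; rewrite normal_pdfE ?gt_eqF//= /normal_fun.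
under eq_fun do rewrite subr0.
rewrite subr0.
have s2 : s ^+ 2 *+ 2 != 0 by rewrite mulrn_eq0/= expf_neq0// gt_eqF.
have d1 : is_derive x (1:R) (fun y : R => - y ^+ 2 / (s ^+ 2 *+ 2)) (- (x / s ^+ 2)).
  apply: is_derive_eq; rewrite /= ?scaler1 /GRing.scale/=.
  by field; rewrite gt_eqF.
have d2 : is_derive x (1:R) (fun y : R => expR (- y ^+ 2 / (s ^+ 2 *+ 2)))
    (- (x / s ^+ 2) * expR (- x ^+ 2 / (s ^+ 2 *+ 2))).
  rewrite mulrC; exact: (is_derive1_comp (is_derive_expR _) d1).
set e := (fun y : R => expR _) in d2 *.
have dk : is_derive x (1:R) (fun y : R => y ^+ k) (k%:R * x ^+ k.-1).
  by have := is_deriveX k (is_derive_id x (1 : R)); rewrite scaler1 exprfctE.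
have d3 := is_deriveM dk (is_deriveZ (normal_peak s) d2).
apply: (is_derive_eq d3); rewrite /e /GRing.scale/= /GRing.scale/= (exprS x k).
move: (expR _) (x ^+ k) (x ^+ k.-1) (k%:R : R) => E u w z.
by field; rewrite gt_eqF.
Qed.

Definition normal_moment (s : R) (k : nat) : R :=
  fine (\int[mu]_x (x ^+ k * normal_pdf 0 s x)%:E).

Lemma normal_moment0 (s : R) : normal_moment s 0 = 1.
Proof.
rewrite /normal_moment; under eq_integral do rewrite expr0 mul1r.
by rewrite integral_normal_pdf.
Qed.

Lemma normal_momentE (s : R) k : 0 < s ->
  (\int[mu]_x (x ^+ k * normal_pdf 0 s x)%:E = (normal_moment s k)%:E)%E.
Proof.
move=> s0; rewrite /normal_moment fineK//.
exact: integrable_fin_num (integrable_exprn_normal_pdf k s0).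
Qed.

(** Stein's identity: the derivative of [x ^+ k] times the density integrates to 0. For [k = 0] the
    coefficient [k%:R] kills the right side, which gives the vanishing first moment. *)
Lemma normal_moment_rec (s : R) k : 0 < s ->
  normal_moment s k.+1 = s ^+ 2 * (k%:R * normal_moment s k.-1).
Proof.
move=> s0; pose g j (x : R) := x ^+ j * normal_pdf 0 s x.
have ig j := integrable_exprn_normal_pdf j s0.
have i1 : mu.-integrable setT (fun x => (k%:R)%:E * (g k.-1 x)%:E)%E.
  by apply: integrableZl => //; exact: ig.
have i2 : mu.-integrable setT (fun x => (s ^- 2)%:E * (g k.+1 x)%:E)%E.
  by apply: integrableZl => //; exact: ig.
have cg j : continuous (g j).
  move=> x; apply: cvgM; first exact: exprn_continuous.
  by apply: continuous_normal_pdf; rewrite gt_eqF.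
have : (\int[mu]_x (k%:R * g k.-1 x - s ^- 2 * g k.+1 x)%:E = 0)%E.
  apply: (@integral_derive_eq0 (g k)).
  - move=> x; exact: is_derive_exprn_normal_pdf.
  - by move=> x; apply: cvgB; apply: cvgMr; exact: cg.
  - rewrite (_ : _ \o _ = (fun x => (k%:R)%:E * (g k.-1 x)%:E)
      \- (fun x => (s ^- 2)%:E * (g k.+1 x)%:E))%E//.
    exact: integrableB.
  - by apply: (@cvg_exprn_normal_pdf s k (fun n => n%:R)) => // n; rewrite normr_nat.
  - by apply: (@cvg_exprn_normal_pdf s k (fun n => - n%:R)) => // n; rewrite normrN normr_nat.
under eq_integral do rewrite EFinB !EFinM.
rewrite integralB// !integralZl//; try exact: ig.
rewrite !normal_momentE// -!EFinM -EFinB => -[/eqP]; rewrite subr_eq0 => /eqP ->.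
by rewrite mulVKf// expf_neq0// gt_eqF.
Qed.

(** A cubic polynomial in a squared norm has degree six in each matrix entry; 3 and 15 are the
    fourth and sixth standard normal moments. *)
Lemma integral_normal_poly6 (s a0 a1 a2 a3 a4 a5 a6 : R) : 0 < s ->
  (\int[normal_prob 0 s]_x
    (a0 + a1 * x + a2 * x ^+ 2 + a3 * x ^+ 3 + a4 * x ^+ 4 + a5 * x ^+ 5
      + a6 * x ^+ 6)%:E
   = (a0 + a2 * s ^+ 2 + 3 * a4 * s ^+ 4 + 15 * a6 * s ^+ 6)%:E)%E.
Proof.
move=> s0; pose g j (x : R) := x ^+ j * normal_pdf 0 s x.
have ig a j : mu.-integrable setT (fun x => a%:E * (g j x)%:E)%E.
  apply: integrableZl => //; exact: integrable_exprn_normal_pdf.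
pose a : seq R := [:: a0; a1; a2; a3; a4; a5; a6].
have E x : a0 + a1 * x + a2 * x ^+ 2 + a3 * x ^+ 3 + a4 * x ^+ 4 + a5 * x ^+ 5
      + a6 * x ^+ 6 = \sum_(i < 7) a`_i * x ^+ i.
  by rewrite !big_ord_recl big_ord0/= /bump/=; ring.
have Eg x : ((\sum_(i < 7) a`_i * x ^+ i) * normal_pdf 0 s x)%:E
    = (\sum_(i < 7) (a`_i)%:E * (g i x)%:E)%E.
  rewrite mulr_suml -sumEFin; apply: eq_bigr => i _.
  by rewrite -EFinM /g mulrA.
under eq_integral do rewrite E.
rewrite integral_normal_prob.
- under eq_integral do rewrite Eg.
  rewrite integral_sum//.
  under eq_bigr => i _.
    rewrite integralZl//; last exact: integrable_exprn_normal_pdf.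
    rewrite normal_momentE//; over.
  rewrite !big_ord_recl big_ord0/= /bump/= -!EFinM -!EFinD; congr EFin.
  by rewrite !normal_moment_rec//= normal_moment0; ring.
- by apply: measurable_sum => i; apply: measurable_funM => //; apply: measurable_funX.
- under eq_fun do rewrite Eg.
  apply: integrable_sum => //= i; exact: ig.
Qed.

End NormalMoments.

(** * Iterated Gaussian integrals *)
Section GaussIter.
Variable R : realType.
Implicit Types (sigma : nat -> R) (s : seq (nat * nat * nat)).

Import HBNNSimple.

(* The integral of a nonnegative function is a supremum over simple functions
   below it, so no measurability is needed here. *)
Lemma le_integral_ge0 (disp : measure_display) (T : measurableType disp)
    (m : {measure set T -> \bar R}) (f g : T -> \bar R) :
  (forall x, 0 <= f x)%E -> (forall x, f x <= g x)%E ->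
  (\int[m]_x f x <= \int[m]_x g x)%E.
Proof.
move=> f0 fg; have g0 x : (0 <= g x)%E by exact: le_trans (f0 x) (fg x).
rewrite !ge0_integralTE//; apply: le_ereal_sup => _ /= [h hf <-].
by exists h => //= x; exact: le_trans (hf x) (fg x).
Qed.

Lemma gauss_iter_ge0 sigma s (F : weights R -> \bar R) :
  (forall W, 0 <= F W)%E -> (0 <= gauss_iter sigma s F)%E.
Proof.
elim: s F => [|k s IH] F F0 /=; first exact: F0.
by apply: integral_ge0 => x _; apply: IH => W; exact: F0.
Qed.

Lemma le_gauss_iter sigma s (F G : weights R -> \bar R) :
  (forall W, 0 <= F W)%E -> (forall W, F W <= G W)%E ->
  (gauss_iter sigma s F <= gauss_iter sigma s G)%E.
Proof.
elim: s F G => [|k s IH] F G F0 FG /=; first exact: FG.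
apply: le_integral_ge0 => x; first by apply: gauss_iter_ge0 => W; exact: F0.
by apply: IH => W; [exact: F0|exact: FG].
Qed.

Lemma gauss_iter_cst sigma s (c : R) :
  gauss_iter sigma s (fun=> c%:E) = c%:E.
Proof.
elim: s => [|k s IH] //=.
under eq_integral do rewrite IH.
by rewrite integral_cst//= /normal_prob integral_normal_pdf mule1.
Qed.

Definition combW s (W1 W2 : weights R) : weights R :=
  fun i a b => if (i, a, b) \in s then W1 i a b else W2 i a b.

(** Both sides integrate in the same order, so no exchange of integrals is involved; [combW] records
    that the outer block is frozen while the inner one varies. *)
Lemma gauss_iter_cat sigma s1 s2 (F : weights R -> \bar R) :
  gauss_iter sigma (s1 ++ s2) F =
  gauss_iter sigma s1 (fun W1 => gauss_iter sigma s2 (fun W2 => F (combW s1 W1 W2))).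
Proof.
elim: s1 F => [|k s1 IH] F //=.
apply: eq_integral => x _; rewrite IH.
congr gauss_iter; apply/funext => W1; congr gauss_iter; apply/funext => W2.
congr F; apply/funext => i; apply/funext => a; apply/funext => b.
by rewrite /updW /combW in_cons; case: eqP.
Qed.

(* Joint Borel measurability of [G t W] in the parameter [t] and in the entries
   of [W] listed in [s], the other entries being [0]. *)
Fixpoint gmeas s : forall (disp : measure_display) (T : measurableType disp),
    (T -> weights R -> R) -> Prop :=
  match s with
  | [::] => fun _ T G => measurable_fun [set: T] (fun t => G t (zeroW R))
  | k :: s' => fun _ T G =>
      gmeas s' (T := (T * measurableTypeR R)%type)
        (fun tx W => G tx.1 (updW W k tx.2))
  end.

(** The hypothesis on [phi] ranges over all measurable spaces because each induction step enlarges
    the parameter space by one real coordinate. *)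
Lemma gmeas_op2 (phi : R -> R -> R) :
  (forall (disp : measure_display) (T : measurableType disp) (f g : T -> R),
     measurable_fun [set: T] f -> measurable_fun [set: T] g ->
     measurable_fun [set: T] (fun t => phi (f t) (g t))) ->
  forall s (disp : measure_display) (T : measurableType disp)
    (G1 G2 : T -> weights R -> R),
  gmeas s G1 -> gmeas s G2 -> gmeas s (fun t W => phi (G1 t W) (G2 t W)).
Proof.
move=> hphi; elim=> [|k s IH] disp T G1 G2 /=; first exact: hphi.
exact: IH.
Qed.

Lemma gmeas_op1 (phi : R -> R) : measurable_fun [set: R] phi ->
  forall s (disp : measure_display) (T : measurableType disp)
    (G : T -> weights R -> R),
  gmeas s G -> gmeas s (fun t W => phi (G t W)).
Proof.
move=> mphi s disp T G hG.
apply: (@gmeas_op2 (fun x _ => phi x) _ s disp T G G) => //.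
by move=> ? ? f g mf mg; exact: measurableT_comp.
Qed.

Lemma gmeas_param s (disp : measure_display) (T : measurableType disp) (f : T -> R) :
  measurable_fun [set: T] f -> gmeas s (fun t _ => f t).
Proof.
elim: s disp T f => [|k s IH] disp T f mf //=.
by apply: (IH _ _ (fun tx : T * measurableTypeR R => f tx.1)); exact: measurableT_comp.
Qed.

Lemma gmeas_entry s (disp : measure_display) (T : measurableType disp) i a b :
  gmeas s (fun (_ : T) W => W i a b).
Proof.
elim: s disp T => [|k s IH] disp T /=; first exact: measurable_cst.
rewrite /updW; case: eqP => _; last exact: IH.
apply: (@gmeas_param _ _ _ (fun tx : T * measurableTypeR R => tx.2)).
exact: measurable_snd.
Qed.

Lemma gmeas_sum s (disp : measure_display) (T : measurableType disp) (I : Type)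
    (r : seq I) (G : I -> T -> weights R -> R) :
  (forall i, gmeas s (G i)) -> gmeas s (fun t W => \sum_(i <- r) G i t W).
Proof.
move=> hG; elim: r => [|i r IH].
  under eq_fun do under eq_fun do rewrite big_nil.
  exact: gmeas_param (measurable_cst _).
under eq_fun do under eq_fun do rewrite big_cons.
apply: (@gmeas_op2 +%R) => // ? ? f g mf mg; exact: measurable_funD.
Qed.

(** Tonelli, applied once per entry: integrating out one coordinate keeps measurability in the
    remaining ones. *)
Lemma measurable_gauss_iter sigma s (disp : measure_display)
    (T : measurableType disp) (G : T -> weights R -> R) :
  (forall t W, 0 <= G t W) -> gmeas s G ->
  measurable_fun [set: T] (fun t => gauss_iter sigma s (fun W => (G t W)%:E)).
Proof.
elim: s disp T G => [|k s IH] disp T G G0 /=.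
  by move=> mG; exact/measurable_EFinP.
move=> mG.
apply: (@measurable_fun_fubini_tonelli_F _ _ T (measurableTypeR R) R
  (normal_prob 0 (sigma k.1.1))
  (fun tx => gauss_iter sigma s (fun W => (G tx.1 (updW W k tx.2))%:E))).
- exact: (IH _ (T * measurableTypeR R)%type (fun tx W => G tx.1 (updW W k tx.2))
    (fun tx W => G0 tx.1 (updW W k tx.2)) mG).
- by move=> tx; apply: gauss_iter_ge0 => W; rewrite lee_fin.
Qed.

(** Unlike monotonicity, additivity of the integral calls for measurability. The parameter [t] lets
    the induction turn the outermost entry into part of the parameter. *)
Lemma gauss_iterD sigma s (disp : measure_display)
    (T : measurableType disp) (G1 G2 : T -> weights R -> R) :
  (forall t W, 0 <= G1 t W) -> (forall t W, 0 <= G2 t W) ->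
  gmeas s G1 -> gmeas s G2 -> forall t,
  (gauss_iter sigma s (fun W => (G1 t W + G2 t W)%:E) =
   gauss_iter sigma s (fun W => (G1 t W)%:E)
   + gauss_iter sigma s (fun W => (G2 t W)%:E))%E.
Proof.
elim: s disp T G1 G2 => [|k s IH] disp T G1 G2 G10 G20 m1 m2 t //=.
pose H1 (tx : T * measurableTypeR R) W := G1 tx.1 (updW W k tx.2).
pose H2 (tx : T * measurableTypeR R) W := G2 tx.1 (updW W k tx.2).
have H10 tx W : 0 <= H1 tx W by exact: G10.
have H20 tx W : 0 <= H2 tx W by exact: G20.
under eq_integral => x _.
  rewrite (IH _ _ H1 H2 H10 H20 m1 m2 (t, x)); over.
rewrite ge0_integralD//.
- by move=> x _; apply: gauss_iter_ge0 => W; rewrite lee_fin.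
- apply: (@measurable_fun_pair2 _ _ _ _ _ _
    (fun tx => gauss_iter sigma s (fun W => (H1 tx W)%:E)) t).
  exact: measurable_gauss_iter.
- by move=> x _; apply: gauss_iter_ge0 => W; rewrite lee_fin.
- apply: (@measurable_fun_pair2 _ _ _ _ _ _
    (fun tx => gauss_iter sigma s (fun W => (H2 tx W)%:E)) t).
  exact: measurable_gauss_iter.
Qed.

Lemma gauss_iter_sum_le sigma s (disp : measure_display)
    (T : measurableType disp) (t : T) (I : eqType) (r : seq I)
    (G : I -> T -> weights R -> R) (c : I -> R) :
  (forall i t W, 0 <= G i t W) -> (forall i, gmeas s (G i)) ->
  (forall i, i \in r -> (gauss_iter sigma s (fun W => (G i t W)%:E) <= (c i)%:E)%E) ->
  (gauss_iter sigma s (fun W => (\sum_(i <- r) G i t W)%:E)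
    <= (\sum_(i <- r) c i)%:E)%E.
Proof.
move=> G0 mG; elim: r => [|i r IH] hc.
  under eq_fun do rewrite big_nil.
  by rewrite gauss_iter_cst big_nil.
under eq_fun do rewrite big_cons.
rewrite (gauss_iterD sigma (G0 i) _ (mG i) (gmeas_sum r mG)); last first.
  by move=> t' W; apply: sumr_ge0 => j _.
rewrite big_cons EFinD leeD//; first by apply: hc; rewrite mem_head.
by apply: IH => j jr; apply: hc; rewrite in_cons jr orbT.
Qed.

(** Markov's inequality for an arbitrary set [P]: its indicator dominates the measurable function
    [max 0 (1 - G)], and this function plus [G] is at least 1. *)
Lemma gauss_iter_markov sigma s (disp : measure_display)
    (T : measurableType disp) (t : T) (G : T -> weights R -> R) (P : set (weights R)) (c : R) :
  (forall t W, 0 <= G t W) -> gmeas s G ->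
  (gauss_iter sigma s (fun W => (G t W)%:E) <= c%:E)%E ->
  (forall W, G t W <= 1 -> P W) ->
  ((1 - c)%:E <= gauss_iter sigma s (fun W => (\1_P W)%:E))%E.
Proof.
move=> G0 mG Gc GP.
pose H (t : T) W := Num.max 0 (1 - G t W).
have H0 t' W : 0 <= H t' W by rewrite /H le_max lexx.
have mH : gmeas s H.
  apply: (@gmeas_op1 (fun x => Num.max 0 (1 - x))) => //.
  by apply: measurable_maxr => //; exact: measurable_funB.
apply: (@le_trans _ _ (gauss_iter sigma s (fun W => (H t W)%:E))); last first.
  apply: le_gauss_iter => W; rewrite lee_fin// /H indicE.
  have [/mem_set ->|nP] := pselect (P W); first by rewrite ge_max ler01 gerBl G0.
  rewrite memNset// ge_max lexx/= subr_le0 leNgt; apply/negP => /ltW /GP; exact: nP.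
have : (1%:E <= gauss_iter sigma s (fun W => (H t W + G t W)%:E))%E.
  rewrite -(gauss_iter_cst sigma s 1); apply: le_gauss_iter => W; rewrite lee_fin//.
  by rewrite -lerBlDr le_max lexx orbT.
rewrite (gauss_iterD sigma H0 G0 mH mG) EFinB leeBlDr// => /le_trans; apply.
by rewrite leeD2l.
Qed.

(** Here [y] is normal with mean [z] and variance [tau], and the right side lists its second, fourth
    and sixth moments. The shift [z] accumulates the entries already fixed by outer integrals. *)
Lemma gauss_iter_row sigma i a (v : nat -> R) (bs : seq nat) (z e0 e2 e4 e6 : R) :
  0 < sigma i -> uniq bs ->
  let tau := sigma i ^+ 2 * \sum_(b <- bs) v b ^+ 2 in
  gauss_iter sigma [seq (i, a, b) | b <- bs]
    (fun W => let y := z + \sum_(b <- bs) W i a b * v b in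
       (e0 + e2 * y ^+ 2 + e4 * y ^+ 4 + e6 * y ^+ 6)%:E)
  = (e0 + e2 * (z ^+ 2 + tau) + e4 * (z ^+ 4 + 6 * z ^+ 2 * tau + 3 * tau ^+ 2)
     + e6 * (z ^+ 6 + 15 * z ^+ 4 * tau + 45 * z ^+ 2 * tau ^+ 2 + 15 * tau ^+ 3))%:E.
Proof.
move=> si; elim: bs z => [|b bs IH] z /=.
  by move=> _; rewrite !big_nil; congr EFin; ring.
move=> /andP[bbs ubs].
set tau := sigma i ^+ 2 * \sum_(b <- bs) v b ^+ 2.
(* Integrating the entries in [bs] leaves the even polynomial with coefficients [c0], [c2], [c4],
   [e6] at [z + w * x]; its expansion in powers of [x] is the integrand below. *)
pose c0 := e0 + e2 * tau + 3 * e4 * tau ^+ 2 + 15 * e6 * tau ^+ 3.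
pose c2 := e2 + 6 * e4 * tau + 45 * e6 * tau ^+ 2.
pose c4 := e4 + 15 * e6 * tau.
pose w := v b.
transitivity (\int[normal_prob 0 (sigma i)]_x
  ((c0 + c2 * z ^+ 2 + c4 * z ^+ 4 + e6 * z ^+ 6)
   + (w * (2 * c2 * z + 4 * c4 * z ^+ 3 + 6 * e6 * z ^+ 5)) * x
   + (w ^+ 2 * (c2 + 6 * c4 * z ^+ 2 + 15 * e6 * z ^+ 4)) * x ^+ 2
   + (w ^+ 3 * (4 * c4 * z + 20 * e6 * z ^+ 3)) * x ^+ 3
   + (w ^+ 4 * (c4 + 15 * e6 * z ^+ 2)) * x ^+ 4
   + (w ^+ 5 * (6 * e6 * z)) * x ^+ 5
   + (w ^+ 6 * e6) * x ^+ 6)%:E)%E.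
  apply: eq_integral => x _.
  transitivity (gauss_iter sigma [seq (i, a, b0) | b0 <- bs]
    (fun W => let y := (z + w * x) + \sum_(b <- bs) W i a b * v b in
       (e0 + e2 * y ^+ 2 + e4 * y ^+ 4 + e6 * y ^+ 6)%:E)).
    congr gauss_iter; apply/funext => W /=.
    suff -> : \sum_(b1 <- b :: bs) updW W (i, a, b) x i a b1 * v b1 =
      w * x + \sum_(b <- bs) W i a b * v b by rewrite addrA.
    rewrite big_cons /updW eqxx mulrC; congr (_ + _).
    apply: eq_big_seq => b' b'bs; rewrite xpair_eqE eqxx/=.
    by rewrite (negbTE (_ : b' != b))//; apply: contraNneq bbs => <-.
  rewrite IH//; congr EFin; rewrite -/tau /c0 /c2 /c4; ring.
have -> : sigma i ^+ 2 * \sum_(b0 <- b :: bs) v b0 ^+ 2 = sigma i ^+ 2 * w ^+ 2 + tau.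
  by rewrite big_cons mulrDr.
rewrite integral_normal_poly6//; congr EFin; rewrite /c0 /c2 /c4; ring.
Qed.

(** The sum of squares is [tau] times a chi-squared variable with [r] degrees of freedom, whose
    moments are [r], [r (r + 2)] and [r (r + 2) (r + 4)]. The shift [c] accumulates the rows already
    fixed. *)
Lemma gauss_iter_rows sigma i (v : nat -> R) (rs bs : seq nat) (c f0 f1 f2 f3 : R) :
  0 < sigma i -> uniq rs -> uniq bs ->
  let tau := sigma i ^+ 2 * \sum_(b <- bs) v b ^+ 2 in
  let r : R := (size rs)%:R in
  gauss_iter sigma [seq (i, a, b) | a <- rs, b <- bs]
    (fun W => let y := c + \sum_(a <- rs) (\sum_(b <- bs) W i a b * v b) ^+ 2 in
       (f0 + f1 * y + f2 * y ^+ 2 + f3 * y ^+ 3)%:E)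
  = (f0 + f1 * (c + r * tau)
     + f2 * (c ^+ 2 + 2 * c * r * tau + r * (r + 2) * tau ^+ 2)
     + f3 * (c ^+ 3 + 3 * c ^+ 2 * r * tau + 3 * c * (r * (r + 2)) * tau ^+ 2
             + r * (r + 2) * (r + 4) * tau ^+ 3))%:E.
Proof.
move=> si + ubs; elim: rs c => [|a rs IH] c /=.
  by move=> _; rewrite !big_nil; congr EFin; ring.
move=> /andP[ars urs].
set tau := sigma i ^+ 2 * \sum_(b <- bs) v b ^+ 2.
rewrite gauss_iter_cat.
pose r : R := (size rs)%:R.
(* Coefficients, in even powers of the first row's value [Z], of what remains after the other rows
   are integrated; the coefficient of [Z ^+ 6] is [f3]. *)
pose e0 := f0 + f1 * (c + r * tau)
     + f2 * (c ^+ 2 + 2 * c * r * tau + r * (r + 2) * tau ^+ 2)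
     + f3 * (c ^+ 3 + 3 * c ^+ 2 * r * tau + 3 * c * (r * (r + 2)) * tau ^+ 2
             + r * (r + 2) * (r + 4) * tau ^+ 3).
pose e2 := f1 + f2 * (2 * c + 2 * r * tau)
  + f3 * (3 * c ^+ 2 + 6 * c * r * tau + 3 * (r * (r + 2)) * tau ^+ 2).
pose e4 := f2 + f3 * (3 * c + 3 * r * tau).
transitivity (gauss_iter sigma [seq (i, a, b) | b <- bs]
    (fun W => let y := 0 + \sum_(b <- bs) W i a b * v b in
       (e0 + e2 * y ^+ 2 + e4 * y ^+ 4 + f3 * y ^+ 6)%:E)).
  congr gauss_iter; apply/funext => W1 /=.
  set Z := \sum_(b <- bs) W1 i a b * v b.
  transitivity (gauss_iter sigma [seq (i, a, b) | a <- rs, b <- bs]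
    (fun W => let y := (c + Z ^+ 2) + \sum_(a <- rs) (\sum_(b <- bs) W i a b * v b) ^+ 2 in
       (f0 + f1 * y + f2 * y ^+ 2 + f3 * y ^+ 3)%:E)).
    congr gauss_iter; apply/funext => W2 /=.
    suff -> : \sum_(a0 <- a :: rs)
      (\sum_(b <- bs) combW [seq (i, a, b) | b <- bs] W1 W2 i a0 b * v b) ^+ 2 =
      Z ^+ 2 + \sum_(a <- rs) (\sum_(b <- bs) W2 i a b * v b) ^+ 2 by rewrite addrA.
    rewrite big_cons; congr (_ ^+ 2 + _).
      apply: eq_big_seq => b bbs; rewrite /combW ifT//; exact: map_f.
    apply: eq_big_seq => a' a'rs; congr (_ ^+ 2); apply: eq_bigr => b _.
    rewrite /combW ifF//; apply/negbTE/mapP => -[b' _ [aa' _]].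
    by move: ars; rewrite -aa' a'rs.
  rewrite IH//; congr EFin; rewrite -/tau -/r add0r /e0 /e2 /e4; ring.
have -> : (size rs).+1%:R = r + 1 :> R by rewrite -natr1.
rewrite gauss_iter_row//; congr EFin; rewrite -/tau /e0 /e2 /e4; ring.
Qed.

End GaussIter.

(** * Products of layers *)
Section EuclideanNorm.
Variable R : realType.

Lemma cauchy_schwarz_sum (I : Type) (r : seq I) (u v : I -> R) :
  (\sum_(i <- r) u i * v i) ^+ 2
    <= (\sum_(i <- r) u i ^+ 2) * (\sum_(i <- r) v i ^+ 2).
Proof.
elim: r => [|i r IH]; first by rewrite !big_nil expr0n mul0r.
rewrite !big_cons.
set S := \sum_(j <- r) _ in IH *; set U := \sum_(j <- r) u j ^+ 2 in IH *.
set V := \sum_(j <- r) v j ^+ 2 in IH *.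
have U0 : 0 <= U by apply: sumr_ge0 => j _; exact: sqr_ge0.
have V0 : 0 <= V by apply: sumr_ge0 => j _; exact: sqr_ge0.
move: (u i) (v i) => a b.
(* A quadratic form in [a], [b] whose discriminant is nonpositive by the induction hypothesis;
   completing the square multiplies by [U], so [U = 0] is separate. *)
have key : 0 <= U * b ^+ 2 + V * a ^+ 2 - 2 * S * a * b.
  have [UE|Un] := eqVneq U 0.
    have S0 : S = 0.
      by apply/eqP; rewrite -sqrf_eq0 eq_le sqr_ge0 andbT; move: IH; rewrite UE mul0r.
    by rewrite UE S0 mul0r mulr0 !mul0r add0r subr0 mulr_ge0// sqr_ge0.
  have Up : 0 < U by rewrite lt_neqAle eq_sym Un.
  rewrite -(pmulr_rge0 _ Up).
  have -> : U * (U * b ^+ 2 + V * a ^+ 2 - 2 * S * a * b) =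
    (U * b - S * a) ^+ 2 + (U * V - S ^+ 2) * a ^+ 2 by ring.
  by rewrite addr_ge0 ?sqr_ge0// mulr_ge0 ?sqr_ge0// subr_ge0.
rewrite -subr_ge0.
have -> : (a ^+ 2 + U) * (b ^+ 2 + V) - (a * b + S) ^+ 2 =
  (U * V - S ^+ 2) + (U * b ^+ 2 + V * a ^+ 2 - 2 * S * a * b) by ring.
by rewrite addr_ge0// subr_ge0.
Qed.

Lemma norm_sum_mul_le (I : Type) (r : seq I) (u v : I -> R) :
  `|\sum_(i <- r) u i * v i|
    <= Num.sqrt (\sum_(i <- r) u i ^+ 2) * Num.sqrt (\sum_(i <- r) v i ^+ 2).
Proof.
have U0 : 0 <= \sum_(i <- r) u i ^+ 2 by apply: sumr_ge0 => j _; exact: sqr_ge0.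
rewrite -sqrtrM// -sqrtr_sqr ler_wsqrtr//; exact: cauchy_schwarz_sum.
Qed.

(** Vectors are functions on [nat] with the dimension passed apart, so that segments of layers with
    varying widths compose without dependent types. *)
Definition nrm (n : nat) (v : nat -> R) : R :=
  Num.sqrt (\sum_(a <- iota 0 n) v a ^+ 2).

Lemma nrm_ge0 n v : 0 <= nrm n v.
Proof. exact: sqrtr_ge0. Qed.

Lemma sum_sqr_ge0 n (v : nat -> R) : 0 <= \sum_(a <- iota 0 n) v a ^+ 2.
Proof. by apply: sumr_ge0 => a _; exact: sqr_ge0. Qed.

Lemma nrm_sqr n v : nrm n v ^+ 2 = \sum_(a <- iota 0 n) v a ^+ 2.
Proof. by rewrite sqr_sqrtr// sum_sqr_ge0. Qed.

Lemma eq_nrm n (u v : nat -> R) :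
  (forall a, (a < n)%N -> u a = v a) -> nrm n u = nrm n v.
Proof.
move=> uv; congr Num.sqrt; apply: eq_big_seq => a; rewrite mem_iota add0n => /andP[_ an].
by rewrite uv.
Qed.

Lemma nrm0 n : nrm n (fun=> 0) = 0.
Proof. by rewrite /nrm big1 ?sqrtr0// => i _; rewrite expr0n. Qed.

Lemma nrmD n (u v : nat -> R) : nrm n (fun a => u a + v a) <= nrm n u + nrm n v.
Proof.
rewrite -(@ler_pXn2r _ 2)// ?nnegrE ?addr_ge0 ?nrm_ge0//.
rewrite sqrrD !nrm_sqr.
have -> : \sum_(a <- iota 0 n) (u a + v a) ^+ 2 =
  \sum_(a <- iota 0 n) u a ^+ 2 + (\sum_(a <- iota 0 n) u a * v a) *+ 2
  + \sum_(a <- iota 0 n) v a ^+ 2.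
  rewrite -sumrMnl -!big_split/=; apply: eq_bigr => a _.
  by rewrite sqrrD.
rewrite lerD2r lerD2l lerMn2r/=.
exact: le_trans (ler_norm _) (norm_sum_mul_le _ _ _).
Qed.

Lemma nrmZ n (c : R) (v : nat -> R) : nrm n (fun a => c * v a) = `|c| * nrm n v.
Proof.
rewrite /nrm -sqrtr_sqr -sqrtrM ?sqr_ge0//; congr Num.sqrt.
by rewrite mulr_sumr; apply: eq_bigr => a _; rewrite exprMn.
Qed.

Lemma nrm_sum n (I : Type) (r : seq I) (f : I -> nat -> R) :
  nrm n (fun a => \sum_(i <- r) f i a) <= \sum_(i <- r) nrm n (f i).
Proof.
elim: r => [|i r IH].
  by under eq_fun do rewrite big_nil; rewrite nrm0 big_nil.
under eq_fun do rewrite big_cons.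
by rewrite big_cons (le_trans (nrmD _ _ _))// lerD2l.
Qed.

Lemma le_nrm n (v : nat -> R) a : (a < n)%N -> `|v a| <= nrm n v.
Proof.
move=> an; rewrite -sqrtr_sqr ler_wsqrtr//.
rewrite (@bigD1_seq _ _ _ _ _ a) ?iota_uniq ?mem_iota//= lerDl.
by apply: sumr_ge0 => b _; exact: sqr_ge0.
Qed.

(** Triangle inequality over the basis expansion of [v]. The factor [n] instead of its square root
    costs only a polynomial in the depth. *)
Lemma nrm_le_max n (v : nat -> R) c : 0 <= c ->
  (forall a, (a < n)%N -> `|v a| <= c) -> nrm n v <= n%:R * c.
Proof.
move=> c0 vc.
have -> : nrm n v = nrm n (fun a => \sum_(b <- iota 0 n) (a == b)%:R * v b).
  apply: eq_nrm => a an.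
  rewrite (@bigD1_seq _ _ _ _ _ a) ?iota_uniq ?mem_iota//= eqxx mul1r big1 ?addr0//.
  by move=> b; rewrite eq_sym => /negbTE ->; rewrite mul0r.
apply: (le_trans (nrm_sum _ _ (fun b a => (a == b)%:R * v b))).
have -> : n%:R * c = \sum_(b <- iota 0 n) c.
  by rewrite big_const_seq count_predT size_iota iter_addr_0 mulr_natl.
rewrite big_seq [leRHS]big_seq; apply: ler_sum => b; rewrite mem_iota add0n => /andP[_ bn].
apply: le_trans (vc _ bn); rewrite -[leRHS]sqrtr_sqr ler_wsqrtr//.
rewrite (@bigD1_seq _ _ _ _ _ b) ?iota_uniq ?mem_iota//= eqxx mul1r big1 ?addr0//.
by move=> a /negbTE ->; rewrite mul0r expr0n.
Qed.

Definition unitv (b : nat) : nat -> R := fun a => (a == b)%:R.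

Lemma nrm_unitv n b : nrm n (unitv b) <= 1.
Proof.
rewrite /nrm -[leRHS]sqrtr1 ler_wsqrtr//.
have [bn|bn] := boolP (b \in iota 0 n).
  rewrite (@bigD1_seq _ _ _ _ _ b) ?iota_uniq//= /unitv eqxx expr1n big1 ?addr0//.
  by move=> a /negbTE ->; rewrite expr0n.
rewrite big_seq big1// => a an; rewrite /unitv (_ : a == b = false) ?expr0n//.
by apply/negbTE; apply: contraNneq bn => <-.
Qed.

End EuclideanNorm.

(** * Segments of consecutive layers and their stability under perturbation *)

Section Network.
Variables (R : realType) (d : nat -> nat).
Implicit Types (W D : weights R) (v w : nat -> R).

Definition app W (k : nat) v : nat -> R :=
  fun a => \sum_(b <- iota 0 (d k)) W k.+1 a b * v b.

(* [seg W i m v] is W_(i+m) ... W_(i+1) v. *)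
Fixpoint seg W (i m : nat) v : nat -> R :=
  match m with
  | 0 => v
  | m'.+1 => app W (i + m') (seg W i m' v)
  end.

Lemma appD W k u v a : app W k (fun b => u b + v b) a = app W k u a + app W k v a.
Proof. by rewrite -big_split; apply: eq_bigr => b _; rewrite mulrDr. Qed.

Lemma appZ W k c v a : app W k (fun b => c * v b) a = c * app W k v a.
Proof. by rewrite mulr_sumr; apply: eq_bigr => b _; rewrite mulrCA. Qed.

Lemma app_sum W k (I : Type) (r : seq I) (f : I -> nat -> R) a :
  app W k (fun b => \sum_(i <- r) f i b) a = \sum_(i <- r) app W k (f i) a.
Proof.
rewrite /app exchange_big/=; apply: eq_bigr => b _.
by rewrite mulr_sumr.
Qed.

Lemma eq_app W k u v a : (forall b, (b < d k)%N -> u b = v b) -> app W k u a = app W k v a.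
Proof.
move=> uv; apply: eq_big_seq => b; rewrite mem_iota add0n => /andP[_ bn].
by rewrite uv.
Qed.

Lemma segZ W i m c v : seg W i m (fun b => c * v b) = (fun a => c * seg W i m v a).
Proof.
elim: m => [|m IH] //=; rewrite IH; apply/funext => a; exact: appZ.
Qed.

Lemma seg_sum W i m (I : Type) (r : seq I) (f : I -> nat -> R) :
  seg W i m (fun b => \sum_(j <- r) f j b) = (fun a => \sum_(j <- r) seg W i m (f j) a).
Proof.
elim: m => [|m IH] //=; rewrite IH; apply/funext => a; exact: app_sum.
Qed.

Lemma eq_seg W i m u v : (forall b, (b < d i)%N -> u b = v b) ->
  forall a, (a < d (i + m))%N -> seg W i m u a = seg W i m v a.
Proof.
move=> uv; elim: m => [|m IH] a /=; first by rewrite addn0; exact: uv.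
by move=> _; apply: eq_app.
Qed.

Definition subW W W' : weights R := fun i a b => W i a b - W' i a b.

(** Layers are exchanged one at a time: in the term [l], the layers below [i + l] are those of [W'],
    the layer at [i + l] is the difference, and those above are from [W]. *)
Lemma seg_telescope W W' i m v a :
  seg W' i m v a = seg W i m v a + \sum_(l <- iota 0 m)
    seg W (i + l).+1 (m - l.+1) (app (subW W' W) (i + l) (seg W' i l v)) a.
Proof.
elim: m a => [|m IH] a; first by rewrite big_nil addr0.
have -> : iota 0 m.+1 = iota 0 m ++ [:: m] by rewrite -addn1 iotaD.
rewrite big_cat big_seq1/= subnn/=.
have -> : app W' (i + m) (seg W' i m v) a =
    app W (i + m) (seg W' i m v) a + app (subW W' W) (i + m) (seg W' i m v) a.
  by rewrite -big_split/=; apply: eq_bigr => b _; rewrite -mulrDl addrC subrK.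
rewrite addrA; congr (_ + _).
have -> : seg W' i m v = (fun a => seg W i m v a + \sum_(l <- iota 0 m)
    seg W (i + l).+1 (m - l.+1) (app (subW W' W) (i + l) (seg W' i l v)) a).
  exact/funext.
rewrite appD app_sum; congr (_ + _); apply: eq_big_seq => l.
rewrite mem_iota add0n => /andP[_ lm].
have -> : (m.+1 - l.+1 = (m - l.+1).+1)%N by lia.
by rewrite /=; congr (app W _ _ _); lia.
Qed.

Variable (q : nat -> R) (L : nat).
Hypothesis q_gt0 : forall k, (k < L)%N -> 0 < q k.

Definition qprod (i m : nat) : R := \prod_(k <- iota i m) q k.

Lemma qprod_split i l m : (l < m)%N ->
  qprod i m = qprod i l * q (i + l) * qprod (i + l).+1 (m - l.+1).
Proof.
move=> lm; have e : m = (l + (m - l.+1).+1)%N by lia.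
by rewrite /qprod {1}e iotaD big_cat/= big_cons mulrA.
Qed.

Lemma qprod_ge0 i m : (i + m <= L)%N -> 0 <= qprod i m.
Proof.
move=> imL; rewrite /qprod big_seq; apply: prodr_ge0 => k; rewrite mem_iota => hk.
by apply/ltW/q_gt0; lia.
Qed.

Lemma qprod_gt0 i m : (i + m <= L)%N -> 0 < qprod i m.
Proof.
move=> imL; rewrite /qprod big_seq; apply: prodr_gt0 => k; rewrite mem_iota => hk.
by apply/q_gt0; lia.
Qed.

(** All segments are covered, not just the full product: gradients involve prefixes and suffixes,
    and the telescoping expansion involves inner segments. *)
Definition seg_bounded (M : R) W := forall i m w, (i + m <= L)%N ->
  nrm (d (i + m)) (seg W i m w) <= M * qprod i m * nrm (d i) w.

(** By linearity, and since each coordinate of [w] is at most its norm, finitely many basis vectors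
    control all [w]; this is what makes a union bound possible. *)
Lemma seg_bounded_unitv (M : R) W :
  (forall i m, (i + m <= L)%N ->
    \sum_(b <- iota 0 (d i)) nrm (d (i + m)) (seg W i m (unitv R b)) <= M * qprod i m) ->
  seg_bounded M W.
Proof.
move=> hM i m w imL.
have -> : nrm (d (i + m)) (seg W i m w) = nrm (d (i + m)) (fun a =>
    \sum_(b <- iota 0 (d i)) w b * seg W i m (unitv R b) a).
  apply: eq_nrm => a ha.
  rewrite (eq_bigr (fun b => seg W i m (fun c => w b * unitv R b c) a)); last first.
    by move=> b _; rewrite segZ.
  rewrite -[RHS]/((fun a => \sum_(j <- iota 0 (d i)) seg W i m (fun c => w j * unitv R j c) a) a).
  rewrite -(seg_sum W i m (iota 0 (d i)) (fun b c => w b * unitv R b c)).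
  apply: eq_seg => // b bn.
  rewrite (@bigD1_seq _ _ _ _ _ b) ?iota_uniq ?mem_iota//= /unitv eqxx mulr1 big1 ?addr0//.
  by move=> c; rewrite eq_sym => /negbTE ->; rewrite mulr0.
apply: (le_trans (nrm_sum _ _ (fun b a => w b * seg W i m (unitv R b) a))).
apply: le_trans (ler_wpM2r (nrm_ge0 _ _) (hM i m imL)).
rewrite mulr_suml big_seq [leRHS]big_seq; apply: ler_sum => b.
rewrite mem_iota add0n => /andP[_ bn].
by rewrite nrmZ mulrC ler_wpM2l ?nrm_ge0// le_nrm.
Qed.

(** Strong induction on the length: the telescoping terms contain perturbed segments, but only
    strictly shorter ones, already bounded with [2 * M]. *)
Lemma seg_bounded_perturb (M delta : R) W W' :
  0 <= M -> 0 <= delta -> 2 * L%:R * M * delta <= 1 ->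
  seg_bounded M W ->
  (forall k w, (k < L)%N ->
     nrm (d k.+1) (app (subW W' W) k w) <= delta * q k * nrm (d k) w) ->
  seg_bounded (2 * M) W'.
Proof.
move=> M0 de0 hde hW hD i m; elim/ltn_ind: m => m IH w imL.
have Q0 := qprod_ge0 imL.
have -> : nrm (d (i + m)) (seg W' i m w) = nrm (d (i + m)) (fun a =>
  seg W i m w a + \sum_(l <- iota 0 m)
    seg W (i + l).+1 (m - l.+1) (app (subW W' W) (i + l) (seg W' i l w)) a).
  by apply: eq_nrm => a _; exact: seg_telescope.
apply: (le_trans (nrmD _ _ _)).
have -> : 2 * M * qprod i m * nrm (d i) w =
  M * qprod i m * nrm (d i) w + M * qprod i m * nrm (d i) w by ring.
rewrite lerD ?hW//.
apply: (le_trans (nrm_sum _ _ (fun l a => seg W (i + l).+1 (m - l.+1)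
  (app (subW W' W) (i + l) (seg W' i l w)) a))).
(* Each term picks up [M] from the upper segment, [delta] times a rate from the difference and
   [2 * M] from the lower one; the rates recombine to [qprod i m]. *)
apply: (@le_trans _ _ (\sum_(l <- iota 0 m)
  (M * qprod i m * nrm (d i) w * (2 * M * delta)))).
  rewrite big_seq [leRHS]big_seq; apply: ler_sum => l; rewrite mem_iota add0n => /andP[_ lm].
  have e : ((i + l).+1 + (m - l.+1) = i + m)%N by lia.
  have := hW (i + l).+1 (m - l.+1)%N (app (subW W' W) (i + l) (seg W' i l w)).
  rewrite e => /(_ imL) h1; apply: (le_trans h1).
  have h2 : nrm (d (i + l).+1) (app (subW W' W) (i + l) (seg W' i l w)) <=
     delta * q (i + l) * (2 * M * qprod i l * nrm (d i) w).
    have ilL : (i + l < L)%N by lia.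
    apply: (le_trans (hD _ _ ilL)); rewrite ler_wpM2l//.
      by rewrite mulr_ge0// ltW// q_gt0.
    by apply: IH => //; lia.
  have Ml0 : 0 <= M * qprod (i + l).+1 (m - l.+1) by rewrite mulr_ge0// qprod_ge0//; lia.
  apply: (le_trans (ler_wpM2l Ml0 h2)).
  by rewrite (@qprod_split i l m)// le_eqVlt; apply/orP; left; apply/eqP; ring.
rewrite big_const_seq count_predT size_iota iter_addr_0 -[leLHS]mulr_natr -mulrA.
rewrite -[leRHS]mulr1 ler_wpM2l ?mulr_ge0 ?nrm_ge0//.
apply: le_trans hde.
have -> : 2 * L%:R * M * delta = 2 * M * delta * L%:R by ring.
by rewrite ler_wpM2l ?mulr_ge0// ler_nat; lia.
Qed.

Lemma app_entry_le D k w (g : R) : 0 <= g ->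
  (forall a b, (a < d k.+1)%N -> (b < d k)%N -> `|D k.+1 a b| <= g) ->
  nrm (d k.+1) (app D k w) <= (d k.+1)%:R * ((d k)%:R * g) * nrm (d k) w.
Proof.
move=> g0 hg; rewrite -mulrA; apply: nrm_le_max.
  by rewrite !mulr_ge0// nrm_ge0.
move=> a ak; apply: (le_trans (ler_norm_sum _ _ _)).
have -> : (d k)%:R * g * nrm (d k) w = \sum_(b <- iota 0 (d k)) g * nrm (d k) w.
  by rewrite big_const_seq count_predT size_iota iter_addr_0 -mulrA mulr_natl.
rewrite big_seq [leRHS]big_seq; apply: ler_sum => b; rewrite mem_iota add0n => /andP[_ bk].
by rewrite normrM ler_pM// ?hg// le_nrm.
Qed.

End Network.

(** * Contraction of random layers *)
Section Contraction.
Variables (R : realType) (d : nat -> nat).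
Implicit Types (sigma : nat -> R) (W : weights R).

(* [(u - 1)^2 = (s - 1)^2 / (u + 1)^2] for [s = u^2], and
   [1 / (u + 1)^2 >= 1 / (2 (s + 1)) >= (7 - s) / 32]. *)
Lemma le_sqrt_cubic (u : R) : 0 <= u ->
  64 * u <= 25 + 47 * u ^+ 2 - 9 * (u ^+ 2) ^+ 2 + (u ^+ 2) ^+ 3.
Proof.
move=> u0; rewrite -subr_ge0.
have -> : 25 + 47 * u ^+ 2 - 9 * (u ^+ 2) ^+ 2 + (u ^+ 2) ^+ 3 - 64 * u =
  (u - 1) ^+ 2 * (2 * (u ^+ 2 - 3) ^+ 2 + (u - 1) ^+ 2 * (7 - u ^+ 2)) by ring.
rewrite mulr_ge0 ?sqr_ge0//; have [u7|u7] := leP (u ^+ 2) 7.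
  by rewrite addr_ge0// mulr_ge0 ?sqr_ge0 ?subr_ge0.
have -> : 2 * (u ^+ 2 - 3) ^+ 2 + (u - 1) ^+ 2 * (7 - u ^+ 2) =
  32 + (u + 1) ^+ 2 * (u ^+ 2 - 7) by ring.
by rewrite addr_ge0// mulr_ge0 ?sqr_ge0// subr_ge0 ltW.
Qed.

Definition layer_entries (i : nat) : seq (nat * nat * nat) :=
  [seq (i, a, b) | a <- iota 0 (d i), b <- iota 0 (d i.-1)].

(** The root mean square gain times a contraction factor. With [r = d k.+1] the cubic gives the
    factor [1 - 3 / (16 r) + 1 / (8 r^2)], which is at most [1 - 1 / (16 r)] for every [r >= 1],
    with equality at [r = 1]. *)
Definition layer_rate sigma (k : nat) : R :=
  sigma k.+1 * Num.sqrt (d k.+1)%:R * (1 - (16 * (d k.+1)%:R)^-1).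

Lemma layer_rate_gt0 sigma k : 0 < sigma k.+1 -> (0 < d k.+1)%N -> 0 < layer_rate sigma k.
Proof.
move=> s0 d0; rewrite /layer_rate !mulr_gt0// ?sqrtr_gt0 ?ltr0n// subr_gt0.
rewrite invf_lt1 ?mulr_gt0 ?ltr0n//.
by rewrite -natrM ltr1n; lia.
Qed.

Lemma mem_entries L i a b :
  ((i, a, b) \in entries d L) = [&& (0 < i <= L)%N, (a < d i)%N & (b < d i.-1)%N].
Proof.
apply/flatten_mapP/idP => [[j]|/and3P[hi ha hb]].
  rewrite mem_iota => hj /allpairsP[[a' b']/= [+ +]] [-> -> ->].
  by rewrite !mem_iota => ha hb; lia.
exists i; first by rewrite mem_iota; lia.
apply/allpairsP; exists (a, b); rewrite /= !mem_iota; split => //; lia.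
Qed.

Lemma mem_layer_entries i a b :
  ((i, a, b) \in layer_entries i) = (a < d i)%N && (b < d i.-1)%N.
Proof.
apply/allpairsP/andP => [[[a' b']/= [+ + [-> ->]]]|[ha hb]].
  by rewrite !mem_iota; lia.
by exists (a, b); rewrite /= !mem_iota; split => //; lia.
Qed.

Lemma entriesD j l : entries d (j + l) = entries d j ++
  flatten [seq layer_entries i | i <- iota j.+1 l].
Proof. by rewrite /entries iotaD map_cat flatten_cat add1n. Qed.

Lemma gauss_iter_layer_le sigma k v : 0 < sigma k.+1 -> (0 < d k.+1)%N ->
  (gauss_iter sigma (layer_entries k.+1)
     (fun W => (nrm (d k.+1) (app d W k v))%:E)
   <= (layer_rate sigma k * nrm (d k) v)%:E)%E.
Proof.
move=> s0 d0; rewrite /layer_entries/=.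
have r0 : 0 < (d k.+1)%:R :> R by rewrite ltr0n.
have r1 : 1 <= (d k.+1)%:R :> R by rewrite ler1n.
have sr0 : 0 < Num.sqrt (d k.+1)%:R :> R by rewrite sqrtr_gt0.
have [v0|vn] := eqVneq (nrm (d k) v) 0.
  rewrite v0 mulr0 -(gauss_iter_cst sigma [seq (k.+1, a, b) | a <- iota 0 (d k.+1), b <- iota 0 (d k)] 0).
  apply: le_gauss_iter => W; rewrite lee_fin ?nrm_ge0//.
  rewrite (@eq_nrm _ _ _ (fun=> 0)) ?nrm0// => a _.
  rewrite /app big_seq big1// => b; rewrite mem_iota add0n => /andP[_ bk].
  have := le_nrm v bk; rewrite v0 normr_le0 => /eqP ->; exact: mulr0.
have vp : 0 < nrm (d k) v by rewrite lt_neqAle eq_sym vn nrm_ge0.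
set rb := Num.sqrt (d k.+1)%:R in sr0 *.
have rbE : (d k.+1)%:R = rb ^+ 2 by rewrite sqr_sqrtr// ltW.
pose B := sigma k.+1 * rb * nrm (d k) v.
have B0 : 0 < B by rewrite /B !mulr_gt0.
(* The coefficients of [le_sqrt_cubic] at [u = N / B], multiplied by [B / 64], where [B] is the root
   mean square of the norm [N]. *)
pose f0 := B * 25 / 64; pose f1 := 47 / (64 * B).
pose f2 := - 9 / (64 * B ^+ 3); pose f3 := 1 / (64 * B ^+ 5).
apply: (@le_trans _ _ (gauss_iter sigma
   [seq (k.+1, a, b) | a <- iota 0 (d k.+1), b <- iota 0 (d k)]
   (fun W => let y := 0 + \sum_(a <- iota 0 (d k.+1))
       (\sum_(b <- iota 0 (d k)) W k.+1 a b * v b) ^+ 2 in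
       (f0 + f1 * y + f2 * y ^+ 2 + f3 * y ^+ 3)%:E))).
  apply: le_gauss_iter => W; rewrite lee_fin ?nrm_ge0// add0r.
  have -> : \sum_(a <- iota 0 (d k.+1)) (\sum_(b <- iota 0 (d k)) W k.+1 a b * v b) ^+ 2
    = nrm (d k.+1) (app d W k v) ^+ 2 by rewrite nrm_sqr.
  set N := nrm _ _; pose u := N / B.
  have NE : N = u * B by rewrite /u divfK// gt_eqF.
  have u0 : 0 <= u by rewrite divr_ge0// ?nrm_ge0// ltW.
  rewrite NE.
  have -> : f0 + f1 * (u * B) ^+ 2 + f2 * ((u * B) ^+ 2) ^+ 2 + f3 * ((u * B) ^+ 2) ^+ 3
    = B / 64 * (25 + 47 * u ^+ 2 - 9 * (u ^+ 2) ^+ 2 + (u ^+ 2) ^+ 3).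
    by rewrite /f0 /f1 /f2 /f3; field; rewrite gt_eqF.
  have -> : u * B = B / 64 * (64 * u) by field.
  by apply: ler_wpM2l; [rewrite divr_ge0// ltW|exact: le_sqrt_cubic].
rewrite gauss_iter_rows ?iota_uniq// size_iota lee_fin.
rewrite -nrm_sqr.
have -> : layer_rate sigma k * nrm (d k) v = B * (1 - (16 * (d k.+1)%:R)^-1).
  by rewrite /layer_rate /B -/rb; ring.
set r := (d k.+1)%:R in r0 r1 rbE *.
have -> : sigma k.+1 ^+ 2 * nrm (d k) v ^+ 2 = B ^+ 2 / r.
  by rewrite /B rbE; field; rewrite gt_eqF.
(* The exact mean of the cubic, written as the claimed bound minus a term that is nonnegative
   because [r >= 1]. *)
have -> : f0 + f1 * (0 + r * (B ^+ 2 / r)) +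
  f2 * (0 ^+ 2 + 2 * 0 * r * (B ^+ 2 / r) + r * (r + 2) * (B ^+ 2 / r) ^+ 2) +
  f3 * (0 ^+ 3 + 3 * 0 ^+ 2 * r * (B ^+ 2 / r) + 3 * 0 * (r * (r + 2)) * (B ^+ 2 / r) ^+ 2 +
    r * (r + 2) * (r + 4) * (B ^+ 2 / r) ^+ 3)
  = B * (1 - (16 * r)^-1) - B / (8 * r) * (1 - r^-1).
  by rewrite /f0 /f1 /f2 /f3; field; rewrite !gt_eqF.
rewrite gerBl mulr_ge0//; first by rewrite divr_ge0 ?mulr_ge0// ltW.
by rewrite subr_ge0 invf_le1.
Qed.

Lemma seg_combW j i m v W1 W2 : (i + m <= j)%N ->
  forall a, (a < d (i + m))%N ->
  seg d (combW (entries d j) W1 W2) i m v a = seg d W1 i m v a.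
Proof.
elim: m => [|m IH] imj a //= ha; apply: eq_big_seq => b; rewrite mem_iota add0n => /andP[_ hb].
rewrite IH//; last by lia.
congr (_ * _); rewrite /combW mem_entries ifT//.
move: ha; rewrite addnS => ha; rewrite ha hb !andbT/=; lia.
Qed.

(** Induction on [m], removing the top layer. Entries are listed by increasing layer, so once the
    lower layers are fixed the input of the top one is a fixed vector, and the later layers
    integrate a constant. *)
Lemma gauss_iter_seg_le sigma L i m v :
  (forall k, (k < L)%N -> 0 < sigma k.+1) -> (forall k, (k < L)%N -> (0 < d k.+1)%N) ->
  (i + m <= L)%N ->
  (gauss_iter sigma (entries d L) (fun W => (nrm (d (i + m)) (seg d W i m v))%:E)
   <= (qprod (layer_rate sigma) i m * nrm (d i) v)%:E)%E.
Proof.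
move=> s0 d0; elim: m v => [|m IH] v imL.
  by rewrite /= addn0 gauss_iter_cst /qprod big_nil mul1r.
have kL : (i + m < L)%N by lia.
have imL' : (i + m <= L)%N by lia.
pose k := (i + m)%N.
have q0 := layer_rate_gt0 (s0 _ kL) (d0 _ kL).
(* Scaling the input vector places the new rate inside the integral, so no constant has to be moved
   across the iterated integral. *)
have := IH (fun b => layer_rate sigma (i + m) * v b) imL'.
rewrite nrmZ (ger0_norm (ltW q0)) => IH1.
have -> : qprod (layer_rate sigma) i m.+1 * nrm (d i) v =
  qprod (layer_rate sigma) i m * (layer_rate sigma (i + m) * nrm (d i) v).
  by rewrite (@qprod_split _ _ i m m.+1)// subnn [qprod _ _ 0]/qprod big_nil; ring.
apply: le_trans IH1.
have LE : L = (k + (1 + (L - k.+1)))%N by rewrite /k; lia.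
rewrite {1 2}LE entriesD [X in (X <= _)%E]gauss_iter_cat [X in (_ <= X)%E]gauss_iter_cat.
apply: le_gauss_iter => W1.
  by apply: gauss_iter_ge0 => W; rewrite lee_fin nrm_ge0.
rewrite -/k [X in (_ <= X)%E](_ : _ = (layer_rate sigma k * nrm (d k) (seg d W1 i m v))%:E); last first.
  rewrite -[RHS](gauss_iter_cst sigma (layer_entries k.+1 ++ flatten [seq layer_entries i | i <- iota k.+2 (L - k.+1)])).
  congr gauss_iter; apply/funext => W2; congr EFin.
  rewrite segZ nrmZ (ger0_norm (ltW q0)); congr (_ * _).
  by apply: eq_nrm => a ha; rewrite seg_combW.
rewrite gauss_iter_cat.
apply: le_trans (gauss_iter_layer_le _ (s0 _ kL) (d0 _ kL)).
apply: le_gauss_iter => W2.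
  by apply: gauss_iter_ge0 => W; rewrite lee_fin nrm_ge0.
rewrite -[leRHS](gauss_iter_cst sigma (flatten [seq layer_entries i | i <- iota k.+2 (L - k.+1)])).
apply: le_gauss_iter => W3; rewrite lee_fin ?nrm_ge0//.
rewrite le_eqVlt; apply/orP; left; apply/eqP.
rewrite addnS; apply: eq_nrm => a ha /=.
apply: eq_big_seq => b; rewrite mem_iota add0n => /andP[_ hb].
congr (_ * _); last exact: seg_combW.
rewrite /combW mem_entries ifF; last by rewrite /k; apply/negbTE; lia.
by rewrite mem_layer_entries ha hb.
Qed.

Lemma gmeas_seg s (disp : measure_display) (T : measurableType disp) i m v a :
  gmeas s (fun (_ : T) W => seg d W i m v a).
Proof.
elim: m a => [|m IH] a /=; first exact: gmeas_param (measurable_cst _).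
apply: (@gmeas_sum R s disp T _ _ (fun b _ W => W (i + m).+1 a b * seg d W i m v b)) => b.
apply: (@gmeas_op2 R (fun x y => x * y)) => //; last exact: gmeas_entry.
by move=> ? ? f g mf mg; exact: measurable_funM.
Qed.

Lemma gmeas_nrm_seg s (disp : measure_display) (T : measurableType disp) n i m v :
  gmeas s (fun (_ : T) W => nrm n (seg d W i m v)).
Proof.
apply: (@gmeas_op1 R (fun x => Num.sqrt x)).
  by apply: continuous_measurable_fun; exact: sqrt_continuous.
apply: (@gmeas_sum R s disp T _ _ (fun b _ W => seg d W i m v b ^+ 2)) => b.
apply: (@gmeas_op1 R (fun x => x ^+ 2)); last exact: gmeas_seg.
exact: measurable_funX.
Qed.

End Contraction.

(** * The loss and its gradient *)
Section Loss.
Variables (R : realType) (d : nat -> nat).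
Implicit Types (W : weights R).

Lemma sum_iota_ord n (F : nat -> R) : \sum_(a <- iota 0 n) F a = \sum_(a < n) F a.
Proof. by rewrite -(big_mkord xpredT F) /index_iota subn0. Qed.

Definition mxcol (n : nat) (X : 'M[R]_(d 0, n)) (j : 'I_n) : nat -> R :=
  fun a => if insub a is Some a' then X a' j else 0.

Lemma mxcolE n (X : 'M[R]_(d 0, n)) j (a : 'I_(d 0)) : mxcol X j a = X a j.
Proof. by rewrite /mxcol valK. Qed.

Lemma prodW_mulmxE W n (X : 'M[R]_(d 0, n)) k (i : 'I_(d k)) j :
  (prodW d W k *m X) i j = seg d W 0 k (mxcol X j) i.
Proof.
elim: k i => [|k IH] i /=; first by rewrite mul1mx mxcolE.
rewrite -mulmxA mxE /app sum_iota_ord add0n; apply: eq_bigr => b _.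
by rewrite IH mxE.
Qed.

Lemma residualE W L n alpha (X : 'M[R]_(d 0, n)) (Y : 'M[R]_(d L, n)) i j :
  (alpha *: (prodW d W L *m X) - Y) i j = alpha * seg d W 0 L (mxcol X j) i - Y i j.
Proof. by rewrite mxE [X in X + _]mxE [X in _ + X]mxE prodW_mulmxE. Qed.

Lemma frob2_mxcol n (X : 'M[R]_(d 0, n)) :
  frob2 X = \sum_(j < n) nrm (d 0) (mxcol X j) ^+ 2.
Proof.
rewrite /frob2 exchange_big/=; apply: eq_bigr => j _.
by rewrite nrm_sqr sum_iota_ord; apply: eq_bigr => i _; rewrite mxcolE.
Qed.

Lemma frob2_ge0 m p (A : 'M[R]_(m, p)) : 0 <= frob2 A.
Proof. by apply: sumr_ge0 => i _; apply: sumr_ge0 => j _; exact: sqr_ge0. Qed.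

Lemma frob_ge0 m p (A : 'M[R]_(m, p)) : 0 <= frob A.
Proof. exact: sqrtr_ge0. Qed.

Lemma frob_sqr m p (A : 'M[R]_(m, p)) : frob A ^+ 2 = frob2 A.
Proof. by rewrite sqr_sqrtr// frob2_ge0. Qed.

Lemma frob2_pair m p (A : 'M[R]_(m, p)) :
  frob2 A = \sum_(x : 'I_m * 'I_p) A x.1 x.2 ^+ 2.
Proof. by rewrite /frob2 pair_big. Qed.

Lemma frob2B m p (A B : 'M[R]_(m, p)) :
  `|frob2 (A - B) - frob2 B| <= frob A ^+ 2 + 2 * frob A * frob B.
Proof.
have -> : frob2 (A - B) - frob2 B = frob2 A
    - 2 * \sum_(x : 'I_m * 'I_p) A x.1 x.2 * B x.1 x.2.
  rewrite !frob2_pair mulr_sumr -!sumrB; apply: eq_bigr => x _; rewrite !mxE; ring.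
apply: (le_trans (ler_normB _ _)).
rewrite frob_sqr (ger0_norm (frob2_ge0 _)) lerD2l normrM ger0_norm// -mulrA ler_wpM2l//.
rewrite /frob !frob2_pair; exact: norm_sum_mul_le.
Qed.

Lemma frobB_le m p (A B : 'M[R]_(m, p)) : frob (A - B) <= frob A + frob B.
Proof.
rewrite -(@ler_pXn2r _ 2)// ?nnegrE ?addr_ge0 ?frob_ge0//.
have := frob2B A B; rewrite ler_norml => /andP[_]; rewrite -!frob_sqr.
by move=> h; rewrite sqrrD -mulr_natl; lra.
Qed.

Lemma eq_segW W W' i m v : (forall k a b, (i < k <= i + m)%N -> W' k a b = W k a b) ->
  seg d W' i m v = seg d W i m v.
Proof.
elim: m => [|m IH] h //=; rewrite IH; last by move=> k a b ?; apply: h; lia.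
by apply/funext => a; apply: eq_bigr => b _; rewrite h//; lia.
Qed.

(** Only the telescoping term of the modified layer survives, so the output is affine in each single
    entry. *)
Lemma seg_updW W L k a b (x : R) v : (k < L)%N -> (b < d k)%N ->
  seg d (updW W (k.+1, a, b) x) 0 L v =
  (fun c => seg d W 0 L v c + (x - W k.+1 a b)
     * (seg d W 0 k v b * seg d W k.+1 (L - k.+1) (unitv R a) c)).
Proof.
move=> kL bk; apply/funext => c; rewrite (seg_telescope d W); congr (_ + _).
rewrite (@bigD1_seq _ _ _ _ _ k) ?iota_uniq ?mem_iota//= add0n.
have app0 l v' : l != k ->
    app d (subW (updW W (k.+1, a, b) x) W) l v' = (fun=> 0).
  move=> lk; apply/funext => c'; apply: big1 => b' _.
  by rewrite /subW /updW !xpair_eqE eqSS (negbTE lk)/= subrr mul0r.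
rewrite [X in _ + X]big1 ?addr0; last first.
  move=> l lk; rewrite add0n app0//.
  rewrite (_ : (fun=> 0) = (fun=> 0 * 0 : R)); last by apply/funext => ?; rewrite mul0r.
  by rewrite (@segZ R d W l.+1 (L - l.+1) 0 (fun=> 0)) mul0r.
have -> : seg d (updW W (k.+1, a, b) x) 0 k v = seg d W 0 k v.
  apply: eq_segW => k' a' b' hk; rewrite /updW !xpair_eqE.
  by rewrite (_ : (k' == k.+1) = false)//; apply/negbTE; lia.
have -> : app d (subW (updW W (k.+1, a, b) x) W) k (seg d W 0 k v) =
  (fun c => ((x - W k.+1 a b) * seg d W 0 k v b) * unitv R a c).
  apply/funext => c'; rewrite /app (@bigD1_seq _ _ _ _ _ b) ?iota_uniq ?mem_iota//=.
  rewrite [X in _ + X]big1 ?addr0; last first.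
    move=> b' /negbTE bb; rewrite /subW /updW !xpair_eqE bb andbF subrr mul0r//.
  rewrite /subW /updW !xpair_eqE !eqxx andbT/= /unitv.
  by case: eqP => [->|_]; rewrite ?mulr1// subrr mul0r mulr0.
by rewrite segZ mulrA.
Qed.

(** Along one weight entry the loss is a quadratic polynomial centred at the current value [w], and
    only its linear coefficient contributes. *)
Lemma derive1_half_sum_sqr (I : finType) (r h : I -> R) (w : R) :
  derive1 (fun x : R => 2^-1 * \sum_i (r i + (x - w) * h i) ^+ 2) w =
  \sum_i r i * h i.
Proof.
pose A := \sum_i r i ^+ 2; pose B := \sum_i r i * h i; pose C := \sum_i h i ^+ 2.
have -> : (fun x : R => 2^-1 * \sum_i (r i + (x - w) * h i) ^+ 2) =
   (fun x : R => 2^-1 * A + (x - w) * B + 2^-1 * C * (x - w) ^+ 2).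
  apply/funext => x; rewrite /A /B /C !mulr_sumr mulr_suml -!big_split/=.
  by apply: eq_bigr => i _; field.
have d1 : is_derive w (1:R) (fun x : R => x - w) 1.
  have := is_deriveD (is_derive_id w (1 : R)) (is_derive_cst (- w) w (1 : R)).
  by rewrite addr0.
have d2 := is_deriveX 2 d1.
have d3 := is_deriveZ (2^-1 * C) d2.
have d4 := is_deriveZ B d1.
have d5 := is_deriveD (is_deriveD (is_derive_cst (2^-1 * A) w (1:R)) d4) d3.
rewrite derive1E.
rewrite (_ : (fun x => _) = (cst (2^-1 * A) + B \*: (fun x : R => x - w)
   + (2^-1 * C) \*: (fun x : R => x - w) ^+ 2)).
  rewrite (@derive_val _ _ _ _ _ _ _ d5) /= subrr expr1 mulr0 scale0r scaler0 addr0 add0r.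
  by rewrite /GRing.scale/= mulr1.
apply/funext => x; rewrite /cst !fctE /GRing.scale/= /GRing.scale/=.
by rewrite (mulrC B).
Qed.

Lemma grad_lossE W L n alpha (X : 'M[R]_(d 0, n)) (Y : 'M[R]_(d L, n)) k a b :
  (k < L)%N -> (b < d k)%N ->
  grad_loss alpha X Y W k.+1 a b =
  \sum_(j < n) alpha * seg d W 0 k (mxcol X j) b *
    \sum_(i < d L) (alpha *: (prodW d W L *m X) - Y) i j
      * seg d W k.+1 (L - k.+1) (unitv R a) i.
Proof.
move=> kL bk; rewrite /grad_loss.
pose r (x : 'I_(d L) * 'I_n) := (alpha *: (prodW d W L *m X) - Y) x.1 x.2.
pose h (x : 'I_(d L) * 'I_n) := alpha * (seg d W 0 k (mxcol X x.2) b
  * seg d W k.+1 (L - k.+1) (unitv R a) x.1).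
have -> : (fun x : R => loss alpha X Y (updW W (k.+1, a, b) x)) =
  (fun x : R => 2^-1 * \sum_x0 (r x0 + (x - W k.+1 a b) * h x0) ^+ 2).
  apply/funext => x; rewrite /loss frob2_pair; congr (_ * _).
  apply: eq_bigr => -[i j] _; congr (_ ^+ 2).
  rewrite /r /h/= !residualE seg_updW//; ring.
rewrite derive1_half_sum_sqr -(pair_bigA _ (fun i j => r (i, j) * h (i, j)))/= exchange_big/=.
apply: eq_bigr => j _; rewrite mulr_sumr; apply: eq_bigr => i _.
rewrite /r /h/=; ring.
Qed.

Lemma frob_cols L n (A : 'M[R]_(d L, n)) :
  frob A = Num.sqrt (\sum_(j < n) Num.sqrt (\sum_(i < d L) A i j ^+ 2) ^+ 2).
Proof.
congr Num.sqrt; rewrite /frob2 exchange_big/=; apply: eq_bigr => j _.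
by rewrite sqr_sqrtr//; apply: sumr_ge0 => i _; exact: sqr_ge0.
Qed.

Variable (q : nat -> R) (L : nat).
Hypothesis q_gt0 : forall k, (k < L)%N -> 0 < q k.

(** The segments below and above the differentiated layer together omit exactly the rate [q k],
    hence the quotient. Cauchy-Schwarz over the columns supplies the two Frobenius norms. *)
Lemma grad_loss_le W (M : R) n alpha (X : 'M[R]_(d 0, n)) (Y : 'M[R]_(d L, n)) k a b :
  0 <= M -> 0 <= alpha ->
  seg_bounded d q L M W -> (k < L)%N -> (b < d k)%N ->
  `|grad_loss alpha X Y W k.+1 a b| <=
  M ^+ 2 * (alpha * qprod q 0 L / q k)
    * frob (alpha *: (prodW d W L *m X) - Y) * frob X.
Proof.
move=> M0 al0 hW kL bk; rewrite grad_lossE//.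
set A := _ - Y.
pose G := M * qprod q k.+1 (L - k.+1).
pose H := M * qprod q 0 k.
have G0 : 0 <= G by rewrite mulr_ge0// (qprod_ge0 q_gt0)//; lia.
have H0 : 0 <= H by rewrite mulr_ge0// (qprod_ge0 q_gt0)//; lia.
pose rj j := Num.sqrt (\sum_(i < d L) A i j ^+ 2).
apply: (@le_trans _ _ (\sum_(j < n) (alpha * H * G) * (rj j * nrm (d 0) (mxcol X j)))).
  apply: (le_trans (ler_norm_sum _ _ _)); apply: ler_sum => j _.
  have h1 : `|seg d W 0 k (mxcol X j) b| <= H * nrm (d 0) (mxcol X j).
    apply: (le_trans (le_nrm _ bk)).
    by have := hW 0 k (mxcol X j); rewrite add0n; apply; lia.
  have h2 : `|\sum_(i < d L) A i j * seg d W k.+1 (L - k.+1) (unitv R a) i| <= rj j * G.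
    apply: (le_trans (norm_sum_mul_le _ _ _)); rewrite ler_wpM2l ?sqrtr_ge0//.
    have := hW k.+1 (L - k.+1)%N (unitv R a); rewrite subnKC// => /(_ (leqnn _)) h.
    rewrite -(sum_iota_ord (d L) (fun i => seg d W k.+1 (L - k.+1) (unitv R a) i ^+ 2)).
    apply: (le_trans h); rewrite -[leRHS]mulr1 ler_wpM2l//.
    exact: nrm_unitv.
  rewrite !normrM (ger0_norm al0).
  have -> : alpha * H * G * (rj j * nrm (d 0) (mxcol X j)) =
    alpha * (H * nrm (d 0) (mxcol X j)) * (rj j * G) by ring.
  by rewrite ler_pM// ?mulr_ge0// ler_wpM2l.
rewrite -mulr_sumr.
have -> : M ^+ 2 * (alpha * qprod q 0 L / q k) = alpha * H * G.
  rewrite (qprod_split q 0 kL) add0n /H /G; field.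
  by rewrite gt_eqF// q_gt0.
rewrite -[leRHS]mulrA; apply: ler_wpM2l; first by apply: mulr_ge0 => //; exact: mulr_ge0.
apply: (le_trans (ler_norm _)).
apply: (le_trans (norm_sum_mul_le _ rj (fun j => nrm (d 0) (mxcol X j)))).
by rewrite frob_cols /frob frob2_mxcol.
Qed.

Lemma frob_prodW_le W (M : R) n alpha (X : 'M[R]_(d 0, n)) :
  0 <= M -> 0 <= alpha -> seg_bounded d q L M W ->
  frob (alpha *: (prodW d W L *m X)) <= M * (alpha * qprod q 0 L) * frob X.
Proof.
move=> M0 al0 hW.
have Q0 : 0 <= M * (alpha * qprod q 0 L).
  by rewrite !mulr_ge0// (qprod_ge0 q_gt0).
have Q1 : 0 <= M * (alpha * qprod q 0 L) * frob X.
  by apply: mulr_ge0 => //; exact: frob_ge0.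
rewrite -(@ler_pXn2r _ 2)// ?nnegrE ?frob_ge0//.
rewrite exprMn !frob_sqr frob2_mxcol mulr_sumr /frob2 exchange_big/=.
apply: ler_sum => j _.
have -> : \sum_(i < d L) (alpha *: (prodW d W L *m X)) i j ^+ 2 =
  (alpha * nrm (d L) (seg d W 0 L (mxcol X j))) ^+ 2.
  rewrite exprMn nrm_sqr sum_iota_ord mulr_sumr; apply: eq_bigr => i _.
  by rewrite mxE prodW_mulmxE exprMn.
have h0 : 0 <= alpha * nrm (d L) (seg d W 0 L (mxcol X j)) by rewrite mulr_ge0 ?nrm_ge0.
have h1 : 0 <= M * (alpha * qprod q 0 L) * nrm (d 0) (mxcol X j).
  by apply: mulr_ge0 => //; exact: nrm_ge0.
rewrite -exprMn ler_pXn2r ?nnegrE//.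
have := hW 0 L (mxcol X j); rewrite add0n => /(_ (leqnn _)) h.
apply: (le_trans (ler_wpM2l al0 h)).
by rewrite le_eqVlt; apply/orP; left; apply/eqP; ring.
Qed.

End Loss.

(** * Gradient descent *)
(** The output norm is at most one hundredth of the norm of [Y], which changes the squared residual
    by at most a tenth of [frob Y ^+ 2]. *)
Lemma loss_near_half (R : realType) (d : nat -> nat) (L n : nat) (alpha K : R)
    (X : 'M[R]_(d 0, n)) (Y : 'M[R]_(d L, n)) (W : weights R) :
  1 <= K -> K^-1 <= frob Y ->
  frob (alpha *: (prodW d W L *m X)) <= (100 * K)^-1 ->
  4 / 10 * frob2 Y <= loss alpha X Y W <= 6 / 10 * frob2 Y.
Proof.
move=> K1 KY; rewrite invfM => hA.
have := frob2B (alpha *: (prodW d W L *m X)) Y; rewrite /loss -(frob_sqr Y).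
have := frob_ge0 (alpha *: (prodW d W L *m X)).
move: (frob (alpha *: _)) hA (frob2 _) (frob Y) KY => A hA F y KY A0.
have {}hA : A <= y / 100 by lra.
rewrite ler_norml => /andP[h1 h2].
have h3 : A ^+ 2 + 2 * A * y <= y ^+ 2 / 10.
  have y0 : 0 <= y by lra.
  have h4 : A ^+ 2 <= (y / 100) ^+ 2 by rewrite ler_pXn2r ?nnegrE//; lra.
  have h5 : A * y <= y / 100 * y by rewrite ler_wpM2r.
  nra.
by apply/andP; split; lra.
Qed.

Section GradientDescent.
Variables (R : realType) (d : nat -> nat) (q : nat -> R) (L n : nat).
Variables (X : 'M[R]_(d 0, n)) (Y : 'M[R]_(d L, n)) (W0 : weights R).
Variables (alpha eta K M delta T : R).
Hypothesis q_gt0 : forall k, (k < L)%N -> 0 < q k.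
Hypothesis alpha_ge0 : 0 <= alpha.
Hypothesis eta_ge0 : 0 <= eta.
Hypothesis K_ge1 : 1 <= K.
Hypothesis M_ge0 : 0 <= M.
Hypothesis delta_ge0 : 0 <= delta.
Hypothesis X_le : frob X <= K.
Hypothesis Y_itv : K^-1 <= frob Y <= K.
Hypothesis LMdelta : 2 * L%:R * M * delta <= 1.
Hypothesis W0_bounded : seg_bounded d q L M W0.
Hypothesis small_output : 2 * M * (alpha * qprod q 0 L) * K <= (100 * K)^-1.

(** The bound of [grad_loss_le] for the degraded constant [2 * M], with residual at most [2 * K] and
    [frob X] at most [K]. *)
Let g k := (2 * M) ^+ 2 * (alpha * qprod q 0 L / q k) * (2 * K) * K.

(** The left side is the factor from [app_entry_le] for a matrix whose entries have moved by [T]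
    steps of size [eta * g k]. *)
Hypothesis small_steps : forall k, (k < L)%N ->
  (d k.+1)%:R * ((d k)%:R * (T * (eta * g k))) <= delta * q k.

Let K_ge0 : 0 <= K. Proof. exact: le_trans K_ge1. Qed.

Let aQ_ge0 : 0 <= alpha * qprod q 0 L.
Proof. by rewrite mulr_ge0// (qprod_ge0 q_gt0). Qed.

Let g_ge0 k : (k < L)%N -> 0 <= g k.
Proof.
move=> kL; rewrite /g; apply: mulr_ge0 => //; apply: mulr_ge0; last exact: mulr_ge0.
by apply: mulr_ge0; [exact: sqr_ge0|rewrite divr_ge0// ltW// q_gt0].
Qed.

Let output_le W : seg_bounded d q L (2 * M) W ->
  frob (alpha *: (prodW d W L *m X)) <= (100 * K)^-1.
Proof.
move=> hW; apply: le_trans small_output.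
have M20 : 0 <= 2 * M by exact: mulr_ge0.
apply: (le_trans (frob_prodW_le q_gt0 X M20 alpha_ge0 hW)).
by apply: ler_wpM2l => //; exact: mulr_ge0.
Qed.

Let drift_le t k a b := `|gd alpha eta X Y W0 t k.+1 a b - W0 k.+1 a b| <= t%:R * (eta * g k).

Let bounded_of_drift t : t%:R <= T ->
  (forall k a b, (k < L)%N -> (a < d k.+1)%N -> (b < d k)%N -> drift_le t k a b) ->
  seg_bounded d q L (2 * M) (gd alpha eta X Y W0 t).
Proof.
move=> tT hdr.
apply: (seg_bounded_perturb q_gt0 M_ge0 delta_ge0 LMdelta W0_bounded) => k w kL.
have eg0 : 0 <= eta * g k by rewrite mulr_ge0// g_ge0.
apply: (le_trans (@app_entry_le R d _ k w (t%:R * (eta * g k)) _ _)).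
- exact: mulr_ge0.
- by move=> a b ak bk; exact: hdr.
apply: ler_wpM2r; first exact: nrm_ge0.
apply: le_trans (small_steps kL).
by rewrite !ler_wpM2l// ler_wpM2r.
Qed.

(** A bootstrap: small drift at time [t] keeps the segments bounded by [2 * M], which bounds the
    next gradient by [g k] and so the drift at time [t.+1]. *)
Lemma gd_drift t : t%:R <= T ->
  forall k a b, (k < L)%N -> (a < d k.+1)%N -> (b < d k)%N -> drift_le t k a b.
Proof.
elim: t => [|t IH] tT k a b kL ak bk; first by rewrite /drift_le subrr normr0 mul0r.
have tT' : t%:R <= T by apply: le_trans tT; rewrite ler_nat.
have hW := bounded_of_drift tT' (IH tT').
have := IH tT' k a b kL ak bk; rewrite /drift_le /=.
set W := gd alpha eta X Y W0 t in hW *.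
have M20 : 0 <= 2 * M by exact: mulr_ge0.
have hg : `|grad_loss alpha X Y W k.+1 a b| <= g k.
  apply: (le_trans (grad_loss_le q_gt0 X Y a M20 alpha_ge0 hW kL bk)).
  have c0 : 0 <= (2 * M) ^+ 2 * (alpha * qprod q 0 L / q k).
    by apply: mulr_ge0; [exact: sqr_ge0|rewrite divr_ge0// ltW// q_gt0].
  rewrite /g; apply: ler_pM => //; rewrite ?frob_ge0//.
    by apply: mulr_ge0 => //; exact: frob_ge0.
  apply: ler_wpM2l => //; apply: (le_trans (frobB_le _ _)).
  have := output_le hW; have /andP[_ YK] := Y_itv.
  have h100 : 1 <= 100 * K by move: K_ge1; lra.
  have : (100 * K)^-1 <= 1 by rewrite invf_le1// (lt_le_trans ltr01).
  move: K_ge1; lra.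
move=> h; rewrite -addrAC (le_trans (ler_normB _ _))// -natr1 mulrDl mul1r lerD//.
by rewrite normrM (ger0_norm eta_ge0) ler_wpM2l.
Qed.

Lemma gd_loss t : t%:R <= T ->
  4 / 10 * frob2 Y <= loss alpha X Y (gd alpha eta X Y W0 t) <= 6 / 10 * frob2 Y.
Proof.
move=> tT; have /andP[KY _] := Y_itv.
apply: (loss_near_half K_ge1 KY); apply: output_le.
by apply: bounded_of_drift => //; exact: gd_drift.
Qed.

End GradientDescent.

(** * Random initialization *)
(** A single term of the exponential series suffices: its order [N.+1] is chosen so that the power
    of [L] is at least [p + 1], and the spare factor [L] absorbs the constant [D]. *)
Lemma powR_le_expR (R : realType) (a C p gamma : R) : 0 < a -> 0 < gamma ->
  exists L0 : nat, forall L : nat, (L0 <= L)%N ->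
    C * L%:R `^ p <= expR (a * L%:R `^ gamma).
Proof.
move=> a0 g0.
pose N := (Num.truncn ((`|p| + 1) / gamma)).
have hN : p + 1 <= N.+1%:R * gamma.
  have h : (`|p| + 1) / gamma < N.+1%:R by exact: truncnS_gt.
  rewrite -ler_pdivrMr//; apply: le_trans (ltW h).
  by rewrite ler_pM2r ?invr_gt0// lerD2r ler_norm.
pose D := `|C| * N.+1`!%:R / a ^+ N.+1.
have aN0 : 0 < a ^+ N.+1 by exact: exprn_gt0.
exists (Num.truncn D).+1 => L hL.
have L1 : 1 <= L%:R :> R by rewrite ler1n; lia.
have L0 : 0 <= L%:R :> R by [].
have DL : D <= L%:R by apply: le_trans (ltW (truncnS_gt D)) _; rewrite ler_nat.
have y0 : 0 <= a * L%:R `^ gamma by rewrite mulr_ge0 ?powR_ge0// ltW.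
apply: le_trans (expR_ge1Dxn N y0).
have -> : (a * L%:R `^ gamma) ^+ N.+1 = a ^+ N.+1 * L%:R `^ (N.+1%:R * gamma).
  by rewrite exprMn -(powR_mulrn N.+1 (powR_ge0 _ _)) -powRrM (mulrC gamma).
apply: (@le_trans _ _ (`|C| * L%:R `^ p)).
  by rewrite ler_wpM2r ?powR_ge0// ler_norm.
apply: (@le_trans _ _ (a ^+ N.+1 * L%:R `^ (N.+1%:R * gamma) / N.+1`!%:R)); last by rewrite lerDr.
have f0 : 0 < N.+1`!%:R :> R by rewrite ltr0n fact_gt0.
rewrite ler_pdivlMr// mulrAC.
have -> : `|C| * N.+1`!%:R = a ^+ N.+1 * D by rewrite /D; field; rewrite gt_eqF.
rewrite -mulrA ler_wpM2l ?(ltW aN0)//.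
apply: (@le_trans _ _ (L%:R `^ (p + 1))); last by rewrite ler_powR.
rewrite powRD; last by rewrite (gt_eqF (lt_le_trans ltr01 L1)) implybT.
by rewrite powRr1// mulrC ler_wpM2l ?powR_ge0.
Qed.

Section Initialization.
Variables (R : realType) (d : nat -> nat) (sigma : nat -> R) (L : nat) (dmax : R).
Hypothesis sigma_gt0 : forall k, (k < L)%N -> 0 < sigma k.+1.
Hypothesis d_gt0 : forall k, (k < L)%N -> (0 < d k.+1)%N.
Hypothesis d_le : forall i, (i <= L)%N -> (d i)%:R <= dmax.

Let q := layer_rate d sigma.

Let q_gt0 k : (k < L)%N -> 0 < q k.
Proof. by move=> kL; apply: layer_rate_gt0; [exact: sigma_gt0|exact: d_gt0]. Qed.

(** Markov for the sum over at most [L.+1 ^+ 2] segments and [dmax] basis vectors, each term having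
    mean at most [1 / M]. *)
Lemma init_seg_bounded (M : R) (P : set (weights R)) : 0 < M ->
  (forall W, seg_bounded d q L M W -> P W) ->
  ((1 - (L.+1%:R ^+ 2 * dmax) / M)%:E <= init_prob d L sigma P)%E.
Proof.
move=> M0 hP.
(* The normalization is applied to the basis vectors, inside the segment; the real parameter of [G]
   is a dummy demanded by the form of [gmeas]. *)
pose lam i m := (M * qprod q i m)^-1.
pose G (p : nat * nat) (_ : measurableTypeR R) (W : weights R) :=
  \sum_(b <- iota 0 (d p.1)) nrm (d (p.1 + p.2)) (seg d W p.1 p.2 (fun a => lam p.1 p.2 * unitv R b a)).
pose r := [seq p <- [seq (i, m) | i <- iota 0 L.+1, m <- iota 0 L.+1] | (p.1 + p.2 <= L)%N].
have G0 p t W : 0 <= G p t W by apply: sumr_ge0 => b _; exact: nrm_ge0.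
have mG p : gmeas (entries d L) (G p).
  apply: (@gmeas_sum R _ _ (measurableTypeR R) _ _ (fun b _ W => nrm (d (p.1 + p.2))
    (seg d W p.1 p.2 (fun a => lam p.1 p.2 * unitv R b a)))) => b.
  exact: gmeas_nrm_seg.
have lam0 p : p \in r -> 0 < lam p.1 p.2.
  rewrite mem_filter => /andP[hp _]; rewrite invr_gt0 mulr_gt0//.
  exact: qprod_gt0 q_gt0 _ _ hp.
have EG p : p \in r ->
    (gauss_iter sigma (entries d L) (fun W => (G p 0 W)%:E) <= (dmax / M)%:E)%E.
  move=> pr; have l0 := lam0 p pr; move: (pr); rewrite mem_filter => /andP[hp _].
  have Q0 := qprod_gt0 q_gt0 hp.
  apply: (@le_trans _ _ (\sum_(b <- iota 0 (d p.1)) M^-1)%:E).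
    apply: (@gauss_iter_sum_le R sigma _ _ (measurableTypeR R) 0 _ _
      (fun b _ W => nrm (d (p.1 + p.2))
        (seg d W p.1 p.2 (fun a => lam p.1 p.2 * unitv R b a))) (fun=> M^-1)).
    - by move=> b t W; exact: nrm_ge0.
    - by move=> b; exact: gmeas_nrm_seg.
    - move=> b _; apply: (le_trans (gauss_iter_seg_le _ sigma_gt0 d_gt0 hp)).
      rewrite lee_fin nrmZ (gtr0_norm l0).
      apply: (@le_trans _ _ (qprod q p.1 p.2 * (lam p.1 p.2 * 1))).
        by rewrite !ler_wpM2l ?nrm_unitv// ltW.
      by rewrite mulr1 /lam invfM mulrCA divff ?mulr1// gt_eqF.
  rewrite lee_fin big_const_seq count_predT size_iota iter_addr_0 -mulr_natl.
  apply: ler_wpM2r; first by rewrite invr_ge0 ltW.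
  exact: d_le (leq_trans (leq_addr _ _) hp).
have dmax0 : 0 <= dmax by apply: le_trans (d_le (leqnn L)).
have ES : (gauss_iter sigma (entries d L) (fun W => (\sum_(p <- r) G p (0 : measurableTypeR R) W)%:E)
    <= ((L.+1%:R ^+ 2 * dmax) / M)%:E)%E.
  apply: (le_trans (gauss_iter_sum_le G0 mG EG)).
  rewrite lee_fin big_const_seq count_predT iter_addr_0 -[leLHS]mulr_natl -[leRHS]mulrA.
  apply: ler_wpM2r; first by rewrite divr_ge0// ltW.
  rewrite -natrX ler_nat size_filter (leq_trans (count_size _ _))//.
  by rewrite size_allpairs !size_iota mulnn.
apply: (gauss_iter_markov _ (gmeas_sum r mG) ES).
  by move=> t W; apply: sumr_ge0 => p _; exact: G0.
move=> W hW; apply: hP; apply: seg_bounded_unitv => i m imL.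
have pr : (i, m) \in r.
  by rewrite mem_filter imL; apply: allpairs_f; rewrite mem_iota; lia.
have l0 := lam0 _ pr.
have : G (i, m) 0 W <= 1.
  have ur : uniq r.
    by apply: filter_uniq; apply: allpairs_uniq => [||[? ?] [? ?] _ _]//; exact: iota_uniq.
  apply: le_trans hW; rewrite (bigD1_seq (i, m) pr ur)/=.
  by rewrite lerDl; apply: sumr_ge0 => p _; exact: G0.
rewrite /G /=; under eq_bigr do rewrite segZ nrmZ (gtr0_norm l0).
by rewrite -mulr_sumr /lam mulrC ler_pdivrMr ?mul1r// -invr_gt0.
Qed.

End Initialization.

(** * Upper and lower bounds on the rates and their product *)

Section RateProduct.
Variables (R : realType) (d : nat -> nat) (sigma : nat -> R) (L : nat).
Hypothesis d_gt0 : forall k, (k < L)%N -> (0 < d k.+1)%N.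

Lemma layer_rate_sqr k : layer_rate d sigma k ^+ 2 =
  ((d k.+1)%:R * sigma k.+1 ^+ 2) * (1 - (16 * (d k.+1)%:R)^-1) ^+ 2.
Proof. by rewrite /layer_rate !exprMn sqr_sqrtr//; ring. Qed.

(** The contraction factor is at least one half. A lower bound on the rates is needed because the
    motion of a layer is measured relative to its rate. *)
Lemma layer_rate_sqr_ge k : (k < L)%N ->
  (d k.+1)%:R * sigma k.+1 ^+ 2 / 4 <= layer_rate d sigma k ^+ 2.
Proof.
move=> kL; rewrite layer_rate_sqr.
have d1 : 1 <= (d k.+1)%:R :> R by rewrite ler1n d_gt0.
apply: ler_wpM2l; first by rewrite mulr_ge0// sqr_ge0.
have h : (16 * (d k.+1)%:R)^-1 <= 2^-1 :> R by rewrite lef_pV2 ?posrE; lra.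
have -> : 4^-1 = (2^-1) ^+ 2 :> R by field.
by rewrite ler_pXn2r ?nnegrE//; lra.
Qed.

(** Each contraction factor is at most [expR (- (16 * D)^-1)]. The squared form matches the
    hypothesis on [alpha ^+ 2]. *)
Lemma qprod_layer_rate_sqr_le (D : R) :
  (forall k, (k < L)%N -> (d k.+1)%:R <= D) ->
  qprod (layer_rate d sigma) 0 L ^+ 2 <=
  \prod_(1 <= i < L.+1) ((d i)%:R * sigma i ^+ 2) * expR (- (L%:R / (16 * D))) ^+ 2.
Proof.
move=> hD.
have -> : \prod_(1 <= i < L.+1) ((d i)%:R * sigma i ^+ 2) =
  \prod_(k <- iota 0 L) ((d k.+1)%:R * sigma k.+1 ^+ 2).
  by rewrite big_add1 /index_iota subn0.
have -> : expR (- (L%:R / (16 * D))) ^+ 2 =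
  \prod_(k <- iota 0 L) (expR (- (16 * D)^-1) ^+ 2).
  rewrite big_const_seq count_predT size_iota iter_mulr_1 -exprM mulnC exprM.
  by congr (_ ^+ 2); rewrite -expRM_natl mulrN.
rewrite /qprod -prodrXl -big_split/= big_seq [leRHS]big_seq.
apply: ler_prod => k; rewrite mem_iota add0n => /andP[_ kL].
rewrite sqr_ge0/= layer_rate_sqr.
have d1 : 1 <= (d k.+1)%:R :> R by rewrite ler1n d_gt0.
have D1 : 1 <= D by exact: le_trans (hD k kL).
apply: ler_wpM2l; first by rewrite mulr_ge0// sqr_ge0.
have h : (16 * (d k.+1)%:R)^-1 <= 1 :> R by rewrite invf_le1; lra.
rewrite ler_pXn2r ?nnegrE ?expR_ge0//; last by rewrite subr_ge0.
apply: le_trans (expR_ge1Dx _); rewrite lerD2l lerN2.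
rewrite lef_pV2 ?posrE; [|lra|lra].
by rewrite ler_wpM2l// hD.
Qed.

End RateProduct.

(** * Choice of constants and the final estimates *)

Theorem theorem5p1 (R : realType) (gamma K : R) :
  0 < gamma <= 1 -> 1 <= K ->
  exists (c c' : R) (L0 : nat), 0 < c /\ 0 < c' /\
  forall (L : nat) (d : nat -> nat) (n : nat)
         (X : 'M[R]_(d 0, n)) (Wstar : 'M[R]_(d L, d 0))
         (sigma : nat -> R) (alpha eta : R),
    (0 < L)%N ->
    (forall i, (i <= L)%N -> (0 < d i)%N) ->
    (forall i, (i <= L)%N -> (d i)%:R <= K * L%:R `^ (1 - gamma)) ->
    K^-1 <= frob X <= K ->
    K^-1 <= frob (Wstar *m X) <= K ->
    (forall i, (1 <= i <= L)%N -> 0 < sigma i) ->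
    0 < alpha ->
    alpha ^+ 2 * \prod_(1 <= i < L.+1) ((d i)%:R * sigma i ^+ 2) <= L%:R `^ K ->
    (forall i, (1 <= i <= L)%N -> L%:R `^ (- K) <= (d i)%:R * sigma i ^+ 2) ->
    (L0 <= L)%N ->
    0 < eta <= expR (c * L%:R `^ gamma) ->
    ((9 / 10 : R)%:E <=
      init_prob d L sigma (fun W0 =>
        forall t : nat, (t%:R <= expR (c' * L%:R `^ gamma) ->
          4 / 10 * frob2 (Wstar *m X)
            <= loss alpha X (Wstar *m X) (gd alpha eta X (Wstar *m X) W0 t)
            <= 6 / 10 * frob2 (Wstar *m X))%R))%E.
Proof.
move=> /andP[g0 g1] K1; have K0 : 0 < K by exact: lt_le_trans K1.
(* In the step-size condition, [12800 K^4 l^6] comes from the gradient bound, [K^2 l^2] from two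
   widths and [320 K l^4 P] from the inverse of [delta / (4 P)]. With the extra [P] of [hE] this
   explains the exponent [12 + 2 * K]. *)
pose C : R := 128 * 100 * 320 * K ^+ 7.
have a0 : 0 < (32 * K)^-1 by rewrite invr_gt0 mulr_gt0.
have [L0 hL0] := @powR_le_expR R (32 * K)^-1 C (12 + 2 * K) gamma a0 g0.
have c0 : 0 < (64 * K)^-1 by rewrite invr_gt0 mulr_gt0.
exists (64 * K)^-1, (64 * K)^-1, L0; split => //; split => //.
move=> L d n X Wstar sigma alpha eta Lgt0 dgt0 dle /andP[_ XK] Y_itv sgt0 algt0 hprod hlow
  /hL0 hZ /andP[eta0 eta_le].
set l : R := L%:R in dle hprod hlow hZ eta_le *.
set x := l `^ gamma in hZ eta_le *.
pose P := l `^ K.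
(* For widths at most [K * l ^ (1 - gamma)] the product of contraction factors is at most [Z ^- 2];
   [T] is the square root of [Z] and bounds both [eta] and the number of steps. *)
pose Z := expR ((32 * K)^-1 * x).
set T := expR _.
have l1 : 1 <= l by rewrite /l ler1n.
have l0 : 0 < l by exact: lt_le_trans l1.
have P1 : 1 <= P by rewrite -(powRr0 l) ler_powR// ltW.
have P0 : 0 < P by exact: lt_le_trans P1.
have x0 : 0 < x by exact: powR_gt0.
have Z0 : 0 < Z by exact: expR_gt0.
have T0 : 0 < T by exact: expR_gt0.
have TeZ : T * eta <= Z.
  apply: (@le_trans _ _ (T * T)); first by rewrite ler_pM2l.
  rewrite /T -expRD ler_expR le_eqVlt; apply/orP; left; apply/eqP.
  by field; rewrite gt_eqF.
have {}hZ : C * l ^+ 12 * P ^+ 2 <= Z.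
  apply: le_trans hZ; rewrite powRD; last by rewrite (gt_eqF l0) implybT.
  rewrite (mulrC 2) powRrM -/P !powR_mulrn ?(ltW l0) ?(ltW P0)//.
  by rewrite mulrA.
have sg k : (k < L)%N -> 0 < sigma k.+1 by move=> kL; apply: sgt0.
have dg k : (k < L)%N -> (0 < d k.+1)%N by move=> kL; apply: dgt0.
have dl i : (i <= L)%N -> (d i)%:R <= K * l.
  move=> iL; apply: (le_trans (dle i iL)); rewrite ler_pM2l//.
  by rewrite -[leRHS]powRr1 ?(ltW l0)// ler_powR// gerBl ltW.
pose q := layer_rate d sigma.
have qg k : (k < L)%N -> 0 < q k by move=> kL; apply: layer_rate_gt0; [exact: sg|exact: dg].
pose E := alpha * qprod q 0 L.
have E0 : 0 <= E by rewrite mulr_ge0 ?(ltW algt0)// (qprod_ge0 qg).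
have hE : E * Z ^+ 2 <= P.
  have EZ0 : 0 <= E * Z ^+ 2 by apply: mulr_ge0 => //; rewrite exprn_ge0// ltW.
  rewrite -(@ler_pXn2r _ 2)// ?nnegrE ?(ltW P0)//.
  have hq := @qprod_layer_rate_sqr_le R d sigma L dg (K * l `^ (1 - gamma)) (fun k kL => dle k.+1 kL).
  have EZ : expR (- (L%:R / (16 * (K * l `^ (1 - gamma))))) * Z ^+ 2 = 1.
    rewrite /Z -expRM_natl -expRD -[RHS]expR0; congr expR.
    rewrite -/l.
    have -> : l / (16 * (K * l `^ (1 - gamma))) = x / (16 * K).
      have y0 : 0 < l `^ (1 - gamma) by exact: powR_gt0.
      have xy : x * l `^ (1 - gamma) = l.
        by rewrite /x -powRD ?(gt_eqF l0) ?implybT// addrC subrK powRr1// ltW.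
      move: (l `^ (1 - gamma)) y0 xy => y y0 <-.
      by field; rewrite !gt_eqF.
    by field; rewrite gt_eqF.
  set e := expR _ in hq EZ.
  rewrite exprMn {1}/E exprMn.
  apply: (@le_trans _ _ (alpha ^+ 2 * (\prod_(1 <= i < L.+1) ((d i)%:R * sigma i ^+ 2) * e ^+ 2)
     * (Z ^+ 2) ^+ 2)).
    rewrite ler_wpM2r ?exprn_ge0 ?(ltW Z0)//.
    by rewrite ler_wpM2l ?sqr_ge0.
  rewrite [X in X * _]mulrA -[leLHS]mulrA -exprMn EZ expr1n mulr1.
  apply: (le_trans hprod); rewrite -/P.
  by rewrite expr2 ler_peMl// ltW.
(* Since [L.+1 <= 2 * l], the failure probability is at most [4 K l^3 / M], that is, one tenth. *)
pose M := 40 * K * l ^+ 3.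
have M0 : 0 < M by rewrite /M !mulr_gt0 ?exprn_gt0.
(* Chosen so that [2 * l * M * delta] is exactly 1. *)
pose delta := (80 * K * l ^+ 4)^-1.
have de0 : 0 < delta by rewrite invr_gt0 !mulr_gt0 ?exprn_gt0.
have C0 : 0 < C by rewrite /C; apply: mulr_gt0; [lra|exact: exprn_gt0].
have Cl0 : 0 < C * l ^+ 12 * P.
  by apply: mulr_gt0 => //; apply: mulr_gt0 => //; exact: exprn_gt0.
have hEZ : E * Z * (C * l ^+ 12 * P) <= 1.
  have PZ : P * (C * l ^+ 12 * P) <= Z by apply: le_trans hZ; rewrite le_eqVlt; apply/orP; left; apply/eqP; ring.
  rewrite -(ler_pM2r Z0) mul1r.
  have -> : E * Z * (C * l ^+ 12 * P) * Z = (E * Z ^+ 2) * (C * l ^+ 12 * P) by ring.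
  by apply: le_trans PZ; apply: ler_wpM2r => //; exact: ltW.
have Z1 : 1 <= Z.
  by apply: le_trans (expR_ge1Dx _); rewrite lerDl; apply: mulr_ge0; exact: ltW.
have Kge := ltW K0; have lge := ltW l0; have Pge := ltW P0; have Zge := ltW Z0.
have Tge := ltW T0; have etage := ltW eta0; have Mge := ltW M0; have dege := ltW de0.
have alge := ltW algt0.
have Xge0 (y : R) j : 0 <= y -> 0 <= y ^+ j by exact: exprn_ge0.
apply: (@le_trans _ _ (1 - (L.+1%:R ^+ 2 * (K * l)) / M)%:E).
  rewrite lee_fin.
  have h : L.+1%:R <= 2 * l by rewrite -natr1 -/l; lra.
  have h2 : L.+1%:R ^+ 2 * (K * l) <= (2 * l) ^+ 2 * (K * l).
    apply: ler_wpM2r; first exact: mulr_ge0.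
    by rewrite ler_pXn2r ?nnegrE// mulr_ge0.
  have h3 : L.+1%:R ^+ 2 * (K * l) / M <= 10^-1.
    rewrite ler_pdivrMr//; apply: (le_trans h2).
    by rewrite /M le_eqVlt; apply/orP; left; apply/eqP; field.
  lra.
apply: (init_seg_bounded sg dg dl M0) => W0 hW0 t tT.
apply: (@gd_loss R d q L n X (Wstar *m X) W0 alpha eta K M delta T) => //.
- rewrite -/l /M /delta le_eqVlt; apply/orP; left; apply/eqP; field.
  by rewrite !gt_eqF.
- rewrite -/E -[leRHS]mul1r ler_pdivlMr ?mulr_gt0//.
  apply: le_trans hEZ.
  have -> : 2 * M * E * K * (100 * K) = E * 1 * (80 * 100 * K ^+ 3 * l ^+ 3) by rewrite /M; ring.
  apply: ler_pM.
  - by rewrite mulr1.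
  - by rewrite !mulr_ge0// exprn_ge0.
  - exact: ler_wpM2l.
  rewrite -[leLHS]mulr1; apply: ler_pM => //; first by rewrite !mulr_ge0// exprn_ge0.
  apply: ler_pM; rewrite ?Xge0//; first by rewrite !mulr_ge0// exprn_ge0.
  + rewrite /C; apply: ler_pM; rewrite ?Xge0//.
    * lra.
    * by rewrite ler_weXn2l.
  + by rewrite ler_weXn2l.
- move=> k kL; have qk := qg k kL.
  have q2 : (4 * P)^-1 <= q k ^+ 2.
    apply: le_trans (layer_rate_sqr_ge sigma dg kL).
    rewrite invfM mulrC ler_pM2r ?invr_gt0//.
    by rewrite -powRN; apply: hlow.
  (* The gradient bound contains [1 / q k]; multiplying by [q k] clears it and leaves [q k ^+ 2],
     bounded below by [q2]. *)
  rewrite -(ler_pM2r qk) -[leRHS]mulrA -[X in _ <= _ * X]expr2.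
  apply: (@le_trans _ _ (delta * (4 * P)^-1)); last by rewrite ler_pM2l.
  have -> : (d k.+1)%:R * ((d k)%:R * (T * (eta * ((2 * M) ^+ 2
     * (alpha * qprod q 0 L / q k) * (2 * K) * K)))) * q k =
     ((d k.+1)%:R * (d k)%:R) * (128 * 100 * K ^+ 4 * l ^+ 6 * (E * (T * eta))).
    by rewrite /M /E; field; rewrite gt_eqF.
  apply: (@le_trans _ _ ((K * l * (K * l)) * (128 * 100 * K ^+ 4 * l ^+ 6 * (E * Z)))).
    have c1 : 0 <= 128 * 100 * K ^+ 4 * l ^+ 6 by rewrite !mulr_ge0// exprn_ge0.
    have c2 : 0 <= E * (T * eta) by apply: mulr_ge0 => //; exact: mulr_ge0.
    apply: ler_pM.
    - exact: mulr_ge0.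
    - exact: mulr_ge0.
    - by apply: ler_pM => //; apply: dl => //; exact: ltnW.
    by apply: ler_wpM2l => //; exact: ler_wpM2l.
  have -> : delta * (4 * P)^-1 = (320 * K * l ^+ 4 * P)^-1.
    by rewrite /delta; field; rewrite !gt_eqF.
  have den : 0 < 320 * K * l ^+ 4 * P.
    by apply: mulr_gt0 => //; apply: mulr_gt0; [exact: mulr_gt0|exact: exprn_gt0].
  rewrite -[leRHS]mul1r ler_pdivlMr//.
  apply: le_trans hEZ.
  by rewrite /C le_eqVlt; apply/orP; left; apply/eqP; ring.
Qed.
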